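(* Let $\mu$ be a scalar weight and $W$ a ($d\times d$) matrix weight on $\mathbb{R}^d$ that are smooth on an open neighbourhood $O$ of a point $x_0\in\mathbb{R}^d$. Set $$g=\mu W^{-1}\quad\text{and}\quad\nu=\mu/\sqrt{\det g}.$$ Let $M$ be a Riemannian manifold and $\rho\colon O\to U\subseteq M$ a diffeomorphism onto an open set $U$ (a chart around $\rho(x_0)$) in which the metric of $M$ is $g$, i.e. $(\mathrm{d}\rho)^\star\mathrm{d}\rho=g$ on $O=\rho^{-1}(U)$. Let $$D=\begin{bmatrix}0&-(1/\mu)\mathrm{div}\,W\\ \nabla&0\end{bmatrix},\qquad D_M=\begin{bmatrix}0&-(1/\nu)\mathrm{div}_M\,\nu\\ \nabla_M&0\end{bmatrix}.$$ Then the map $$\mathsf P\colon L^2(U,\nu)\oplus L^2(TU,\nu I)\to L^2(\rho^{-1}(U),\mu)\oplus L^2(\rho^{-1}(U);\mathbb{C}^d,W),\qquad \mathsf P\begin{bmatrix}v_1\\ v_2\end{bmatrix}(x)=\begin{bmatrix}v_1(\rho(x))\\ (\mathrm{d}\rho_x)^\star v_2(\rho(x))\end{bmatrix},$$ is an isometry, and $\mathsf P^{-1}D\mathsf P=D_M$.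
   Context: A scalar weight is an a.e. positive function; a matrix weight is a matrix-valued function symmetric and positive definite a.e. Functions on $U\subseteq M$ and on $\rho^{-1}(U)\subseteq\mathbb{R}^d$ are identified through $\rho$; in particular $\nu$ as a weight on $U$ means $\nu(\rho(x))=\mu(x)/\sqrt{\det g(x)}$. $(\mathrm{d}\rho_x)^\star\colon T_{\rho(x)}M\to\mathbb{R}^d$ is the adjoint of $\mathrm{d}\rho_x$ with respect to the Euclidean inner product and the Riemannian metric of $M$ (fields are complex valued, extended complex linearly). The norms are $\int|v_1|^2\nu\,\mathrm{d}y$, $\int|v_2|^2\nu\,\mathrm{d}y$ on $U$ (Riemannian measure $\mathrm{d}y$ and metric norm), and $\int|u_1|^2\mu\,\mathrm{d}x$, $\int\langle Wu_2,u_2\rangle\,\mathrm{d}x$ on $\rho^{-1}(U)$. $\nabla$, $\mathrm{div}$ are the Euclidean operators; $\nabla_M$, $\mathrm{div}_M$ the Riemannian ones. *)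

(* Defs.v *)
From HB Require Import structures.
From mathcomp Require Import all_boot all_order all_algebra.
From mathcomp Require Import all_classical all_reals all_analysis.
From mathcomp Require Import complex.
Set Implicit Arguments.
Unset Strict Implicit.
Unset Printing Implicit Defensive.
Import Order.TTheory GRing.Theory Num.Theory.
Import numFieldNormedType.Exports.
Local Open Scope classical_set_scope.
Local Open Scope ring_scope.

Notation borel T := (g_sigma_algebraType (@open T)).

(* Points and vectors of R^d are row vectors; a matrix A thus acts on the
   vector v (a column in the usual convention) by v *m A^T. *)

Section Euclidean.
Context {R : realType} {d : nat}.
Local Notation E := 'rV[R]_d.
Implicit Types (O : set E) (u f : E -> R) (F : E -> E).

Definition dot (a b : E) : R := \sum_i a 0 i * b 0 i.

Fixpoint Ck (k : nat) O f : Prop :=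
  match k with
  | 0 => forall x, O x -> {for x, continuous f}
  | k'.+1 => (forall x, O x -> differentiable f x) /\
             (forall v : E, Ck k' O (fun x => 'D_v f x))
  end.

Definition smooth_on O f := forall k, Ck k O f.

Definition grad f (x : E) : E := \row_i 'D_(delta_mx 0 i) f x.

Definition diverg F (x : E) : R :=
  \sum_i 'D_(delta_mx 0 i) (fun y => F y 0 i) x.

Definition test_fun O f :=
  smooth_on O f /\
  exists2 K, compact K & K `<=` O /\ (forall x, ~ K x -> f x = 0).

Definition test_field O F :=
  (forall i, smooth_on O (fun x => F x 0 i)) /\
  exists2 K, compact K & K `<=` O /\ (forall x, ~ K x -> F x = 0).

(* d-dimensional Lebesgue measure: the (unique) Borel measure which gives
   every box its volume. *)
Definition is_lebesgue_measure (lam : {measure set (borel E) -> \bar R}) :=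
  forall a b : E, (forall i, a 0 i <= b 0 i) ->
  lam [set x : E | forall i, a 0 i <= x 0 i <= b 0 i] =
  (\prod_i (b 0 i - a 0 i))%:E.

Definition scalar_weight (lam : {measure set (borel E) -> \bar R})
    (mu : E -> R) :=
  measurable_fun [set: borel E] (mu : borel E -> R) /\
  {ae lam, forall x, 0 < mu x}.

Definition matrix_weight (lam : {measure set (borel E) -> \bar R})
    (W : E -> 'M[R]_d) :=
  (forall i j, measurable_fun [set: borel E]
                 ((fun x => W x i j) : borel E -> R)) /\
  {ae lam, forall x, (W x)^T = W x /\
                     forall v : E, v != 0 -> 0 < dot (v *m (W x)^T) v}.

End Euclidean.

Section Manifold.
Context {R : realType} {d : nat}.
Local Notation E := 'rV[R]_d.

(* Charts are written as parametrizations, from R^d to the space. *)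
Record chart (T : Type) := Chart {
  cdom : set E;
  cmap :> E -> T;
  cinv : T -> E }.

Definition cimg T (c : chart T) : set T := c @` cdom c.

Definition is_chart (T : topologicalType) (c : chart T) :=
  [/\ open (cdom c), open (cimg c),
      forall x, cdom c x -> cinv c (c x) = x,
      forall x, cdom c x -> {for x, continuous c} &
      forall p, cimg c p -> {for p, continuous (cinv c)}].

Definition smooth_transition T (c c' : chart T) :=
  forall i, smooth_on (cdom c `&` c @^-1` cimg c')
                      (fun x => cinv c' (c x) 0 i).

(* The atlas is maximal: its members are exactly the diffeomorphisms from open
   subsets of R^d onto open subsets of the manifold. The carrier is pointed
   because the types on which measures live are. *)
Record manifold := Manifold {
  carrier :> ptopologicalType;
  carrier_hausdorff : hausdorff_space carrier;
  carrier_second_countable : @second_countable carrier;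
  atlas : set (chart carrier);
  atlas_chart : forall c, atlas c -> is_chart c;
  atlas_cover : forall p, exists c, atlas c /\ cimg c p;
  atlas_smooth : forall c c', atlas c -> atlas c' -> smooth_transition c c';
  atlas_maximal : forall c, is_chart c ->
    (forall c', atlas c' -> smooth_transition c c' /\ smooth_transition c' c) ->
    atlas c }.

Definition chart_at (M : manifold) (p : M) (c : chart M) :=
  atlas c /\ cimg c p.

Definition some_chart (M : manifold) (p : M) : chart M :=
  projT1 (cid (atlas_cover p)).

(* A tangent vector at p is the assignment, to each chart c around p, of a
   coordinate vector in R^d, subject to the usual transformation law. The
   value at charts not around p carries no information and is set to 0. *)
Definition tangent_law (M : manifold) (p : M) : {pred (chart M -> E)} :=
  fun xi => `[< (forall c, ~ chart_at p c -> xi c = 0) /\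
    (forall c c', chart_at p c -> chart_at p c' ->
       xi c' = 'd (cinv c' \o c) (cinv c p) (xi c)) >].

Record tangent (M : manifold) (p : M) := Tangent {
  tcoord : chart M -> E;
  tcoordP : tcoord \in tangent_law p }.

End Manifold.

Arguments chart R d T : clear implicits.
Arguments manifold R d : clear implicits.

Section TangentSpace.
Context {R : realType} {d : nat} (M : manifold R d) (p : M).

HB.instance Definition _ := [isSub for @tcoord R d M p].
HB.instance Definition _ := [Choice of tangent p by <:].

Fact tangent_submod_closed : submod_closed (@tangent_law R d M p).
Proof.
split=> [|a xi eta].
  by apply/asboolP; split=> // c c' _ _; rewrite !fctE linear0.
move=> /asboolP[xi0 xiE] /asboolP[eta0 etaE]; apply/asboolP; split.
  by move=> c nc; rewrite !fctE xi0// eta0// scaler0 addr0.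
by move=> c c' pc pc'; rewrite !fctE linearP (xiE c)// (etaE c).
Qed.

HB.instance Definition _ := GRing.isSubmodClosed.Build R _
  (@tangent_law R d M p) tangent_submod_closed.
HB.instance Definition _ := [SubChoice_isSubLmodule of tangent p by <:].

End TangentSpace.

Section Riemannian.
Context {R : realType} {d : nat}.
Local Notation E := 'rV[R]_d.

(* The differential at cinv c p of the parametrization c: the tangent vector
   at p having the given coordinates in c. *)
Definition dchart (M : manifold R d) (c : chart R d M) (p : M) (a : E) :
    tangent p :=
  xget 0 [set xi : tangent p | tcoord xi c = a].

(* The differential of a real function at p, computed in some chart. *)
Definition dfun (M : manifold R d) (f : M -> R) (p : M) (xi : tangent p) : R :=
  let c := some_chart p in 'd (f \o c) (cinv c p) (tcoord xi c).

Definition CkM (M : manifold R d) (k : nat) (U : set M) (f : M -> R) :=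
  forall c, atlas c -> Ck k (cdom c `&` c @^-1` U) (f \o c).

Definition CkTM (M : manifold R d) (k : nat) (U : set M)
    (X : forall p : M, tangent p) :=
  forall c, atlas c -> forall i,
    Ck k (cdom c `&` c @^-1` U) (fun x => tcoord (X (c x)) c 0 i).

Record riemannian := Riemannian {
  base :> manifold R d;
  inner : forall p : base, tangent p -> tangent p -> R;
  inner_linear : forall p a (xi eta zeta : tangent p),
    inner (a *: xi + eta) zeta = a * inner xi zeta + inner eta zeta;
  inner_sym : forall p (xi eta : tangent p), inner xi eta = inner eta xi;
  inner_gt0 : forall p (xi : tangent p), xi != 0 -> 0 < inner xi xi;
  inner_smooth : forall c, atlas c -> forall i j,
    smooth_on (cdom c) (fun x => inner (dchart c (c x) (delta_mx 0 i))
                                       (dchart c (c x) (delta_mx 0 j))) }.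

Definition gram (M : riemannian) (c : chart R d M) (x : E) : 'M[R]_d :=
  \matrix_(i, j) inner (dchart c (c x) (delta_mx 0 i))
                       (dchart c (c x) (delta_mx 0 j)).

Definition riemannian_measure (lam : {measure set (borel E) -> \bar R})
    (M : riemannian) (vol : {measure set (borel M) -> \bar R}) :=
  forall (c : chart R d M) (A : set (borel M)), atlas c -> measurable A ->
    A `<=` cimg c ->
    vol A = (\int[lam]_(x in (cdom c `&` c @^-1` A : set (borel E)))
               (Num.sqrt (\det (gram c x)))%:E)%E.

(* The adjoint of a linear map from R^d to T_p M. *)
Definition adjoint (M : riemannian) (p : M) (L : E -> tangent p)
    (eta : tangent p) : E :=
  xget 0 [set a | forall b, dot a b = inner eta (L b)].

Definition gradM (M : riemannian) (f : M -> R) (p : M) : tangent p :=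
  xget 0 [set G : tangent p | forall xi, inner G xi = dfun f xi].

(* (det g)^(-1/2) sum_i d_i ((det g)^(1/2) X^i), computed in some chart. *)
Definition divergM (M : riemannian) (X : forall p : M, tangent p) (p : M) : R :=
  let c := some_chart p in
  let s y := Num.sqrt (\det (gram c y)) in
  (s (cinv c p))^-1 * diverg (fun y => s y *: tcoord (X (c y)) c) (cinv c p).

Definition test_funM (M : riemannian) (U : set M) (f : M -> R) :=
  (forall k, CkM k U f) /\
  exists2 K, compact K & K `<=` U /\ (forall p, ~ K p -> f p = 0).

Definition test_fieldM (M : riemannian) (U : set M)
    (X : forall p : M, tangent p) :=
  (forall k, CkTM k U X) /\
  exists2 K, compact K & K `<=` U /\ (forall p, ~ K p -> X p = 0).

End Riemannian.

Arguments riemannian R d : clear implicits.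

Local Open Scope complex_scope.

(* A pair consists of a complex function and a complex vector field. On R^d
   fields take values in C^d; on M the complexified tangent space at p consists
   of the formal sums xi + i eta, written (xi, eta). Outside of the open set
   under consideration the values are irrelevant. *)
Section Pairs.
Context {R : realType} {d : nat}.
Local Notation E := 'rV[R]_d.

Definition pairR : Type := (E -> R) * (E -> E).
Definition pairC : Type := (E -> R[i]) * (E -> 'rV[R[i]]_d).

Definition re_pair (u : pairC) : pairR :=
  (fun x => complex.Re (u.1 x), fun x => map_mx (@complex.Re R) (u.2 x)).
Definition im_pair (u : pairC) : pairR :=
  (fun x => complex.Im (u.1 x), fun x => map_mx (@complex.Im R) (u.2 x)).

Definition vecC (a b : E) : 'rV[R[i]]_d := \row_j (a 0 j +i* b 0 j).
Definition mk_pair (u v : pairR) : pairC :=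
  (fun x => u.1 x +i* v.1 x, fun x => vecC (u.2 x) (v.2 x)).

Definition tangentC (M : manifold R d) (p : M) : Type :=
  (tangent p * tangent p)%type.

Definition scaleTC (M : manifold R d) (p : M) (z : R[i]) (xi : tangentC p) :
    tangentC p :=
  (complex.Re z *: xi.1 - complex.Im z *: xi.2,
   complex.Re z *: xi.2 + complex.Im z *: xi.1).

Definition addTC (M : manifold R d) (p : M) (xi eta : tangentC p) :
    tangentC p :=
  (xi.1 + eta.1, xi.2 + eta.2).

Definition pairMR (M : manifold R d) : Type :=
  ((M -> R) * (forall p : M, tangent p))%type.
Definition pairMC (M : manifold R d) : Type :=
  ((M -> R[i]) * (forall p : M, tangentC p))%type.

Definition re_pairM (M : manifold R d) (v : pairMC M) : pairMR M :=
  (fun p => complex.Re (v.1 p), fun p => (v.2 p).1).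
Definition im_pairM (M : manifold R d) (v : pairMC M) : pairMR M :=
  (fun p => complex.Im (v.1 p), fun p => (v.2 p).2).
Definition mk_pairM (M : manifold R d) (v w : pairMR M) : pairMC M :=
  (fun p => v.1 p +i* w.1 p, fun p => (v.2 p, w.2 p)).

(* z |-> a z + w *)
Definition lin_pair (a : R[i]) (u w : pairC) : pairC :=
  (fun x => a * u.1 x + w.1 x, fun x => a *: u.2 x + w.2 x).
Definition lin_pairM (M : manifold R d) (a : R[i]) (v w : pairMC M) : pairMC M :=
  (fun p => a * v.1 p + w.1 p, fun p => addTC (scaleTC a (v.2 p)) (w.2 p)).

Definition CkM_pair (M : manifold R d) (k : nat) (U : set M) (v : pairMC M) :=
  [/\ CkM k U (re_pairM v).1, CkTM k U (re_pairM v).2,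
      CkM k U (im_pairM v).1 & CkTM k U (im_pairM v).2].

Definition sqnormC (z : R[i]) : R := complex.Re z ^+ 2 + complex.Im z ^+ 2.

(* <A z, z> for a real symmetric matrix A *)
Definition hermC (A : 'M[R]_d) (z : 'rV[R[i]]_d) : R :=
  complex.Re ((z *m (map_mx (real_complex R) A)^T *m (map_mx (@conjc R) z)^T)
                0 0).

Definition sqnormTC (M : riemannian R d) (p : M) (xi : tangentC p) : R :=
  inner xi.1 xi.1 + inner xi.2 xi.2.

End Pairs.

Arguments pairC R d : clear implicits.
Arguments pairR R d : clear implicits.

Section Spaces.
Context {R : realType} {d : nat}.
Local Notation E := 'rV[R]_d.
Variable lam : {measure set (borel E) -> \bar R}.

Section OnRd.
Variables (mu : E -> R) (W : E -> 'M[R]_d) (O : set (borel E)).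

Definition sqnorm_pair (u : pairC R d) : \bar R :=
  (\int[lam]_(x in O) (sqnormC (u.1 x) * mu x)%:E +
   \int[lam]_(x in O) (hermC (W x) (u.2 x))%:E)%E.

Definition measurable_pair (u : pairC R d) :=
  forall r : pairR R d, r = re_pair u \/ r = im_pair u ->
    measurable_fun O (r.1 : borel E -> R) /\
    forall i, measurable_fun O ((fun x => r.2 x 0 i) : borel E -> R).

Definition L2_pair (u : pairC R d) :=
  measurable_pair u /\ (sqnorm_pair u < +oo)%E.

(* D on differentiable pairs, extended complex linearly *)
Definition DopR (u : pairR R d) : pairR R d :=
  (fun x => - (mu x)^-1 * diverg (fun y => u.2 y *m (W y)^T) x, grad u.1).
Definition Dop (u : pairC R d) : pairC R d :=
  mk_pair (DopR (re_pair u)) (DopR (im_pair u)).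

(* The graph of D as an unbounded operator: f.2 = grad u.1 and
   - mu f.1 = div (W u.2), as distributions on O. *)
Definition Dweak_R (u f : pairR R d) :=
  (forall F, test_field O F ->
     \int[lam]_(x in O) (u.1 x * diverg F x) =
     - \int[lam]_(x in O) dot (f.2 x) (F x)) /\
  (forall phi, test_fun O phi ->
     \int[lam]_(x in O) dot (u.2 x *m (W x)^T) (grad phi x) =
     - \int[lam]_(x in O) (- (mu x * f.1 x) * phi x)).
Definition Dgraph (u f : pairC R d) :=
  [/\ L2_pair u, L2_pair f, Dweak_R (re_pair u) (re_pair f) &
      Dweak_R (im_pair u) (im_pair f)].

End OnRd.

Section OnM.
Variables (M : riemannian R d) (vol : {measure set (borel M) -> \bar R}).
Variables (nu : M -> R) (U : set (borel M)).

Definition sqnorm_pairM (v : pairMC M) : \bar R :=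
  (\int[vol]_(p in U) (sqnormC (v.1 p) * nu p)%:E +
   \int[vol]_(p in U) (sqnormTC (v.2 p) * nu p)%:E)%E.

Definition measurable_pairM (v : pairMC M) :=
  forall r : pairMR M, r = re_pairM v \/ r = im_pairM v ->
    measurable_fun U (r.1 : borel M -> R) /\
    forall c, atlas c -> forall i,
      measurable_fun (cdom c `&` c @^-1` U : set (borel E))
        ((fun x => tcoord (r.2 (c x)) c 0 i) : borel E -> R).

Definition L2_pairM (v : pairMC M) :=
  measurable_pairM v /\ (sqnorm_pairM v < +oo)%E.

Definition DopMR (v : pairMR M) : pairMR M :=
  (fun p => - (nu p)^-1 * divergM (fun q => nu q *: v.2 q) p, gradM v.1).
Definition DopM (v : pairMC M) : pairMC M :=
  mk_pairM (DopMR (re_pairM v)) (DopMR (im_pairM v)).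

Definition DweakM_R (v w : pairMR M) :=
  (forall X, test_fieldM U X ->
     \int[vol]_(p in U) (v.1 p * divergM X p) =
     - \int[vol]_(p in U) inner (w.2 p) (X p)) /\
  (forall phi, test_funM U phi ->
     \int[vol]_(p in U) inner (nu p *: v.2 p) (gradM phi p) =
     - \int[vol]_(p in U) (- (nu p * w.1 p) * phi p)).
Definition DgraphM (v w : pairMC M) :=
  [/\ L2_pairM v, L2_pairM w, DweakM_R (re_pairM v) (re_pairM w) &
      DweakM_R (im_pairM v) (im_pairM w)].

End OnM.

End Spaces.

Definition pullback (R : realType) (d : nat) (M : riemannian R d)
    (rho : chart R d M) (v : pairMC M) : pairC R d :=
  let adj x := adjoint (dchart rho (rho x)) in
  (fun x => v.1 (rho x),
   fun x => vecC (adj x (v.2 (rho x)).1) (adj x (v.2 (rho x)).2)).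

(* Main.v *)
Require Import Defs.
From mathcomp Require Import all_boot all_order all_algebra.
From mathcomp Require Import all_classical all_reals all_analysis.
From mathcomp Require Import complex ring perm measurable_realfun.
Set Implicit Arguments.
Unset Strict Implicit.
Unset Printing Implicit Defensive.
Import Order.TTheory GRing.Theory Num.Theory.
Import numFieldNormedType.Exports.
Local Open Scope classical_set_scope.
Local Open Scope ring_scope.

(** Read in the chart [rho], everything on the manifold becomes a formula on
    [O]. Let [G] be the Gram matrix of the coordinate frame and [s] the square
    root of its determinant. A tangent vector at [rho x] is its coordinate
    vector [a]; its square length is [a G a^T], the adjoint of the differential
    of [rho] sends it to [a G], the Riemannian measure is [s dx], the gradient
    of [f] has coordinates [(grad f) G^-1] and the divergence of a field is
    [s^-1 div (s a)]. The hypothesis on the metric says that [g = G], so that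
    [W = mu G^-1] and [nu s = mu]. The isometry is then the pair of identities
    [|v1|^2 nu s = |v1|^2 mu] and [<W (a G), a G> = mu (a G a^T)], and the
    operators correspond because [W (a G) = mu a = s (nu a)], whence
    [(1/mu) div (W (a G)) = (1/nu) div_M (nu a)], while the adjoint of the
    differential sends the Riemannian gradient to the Euclidean one.

    Four points need an argument.

    - The divergence of a field at a point is computed in an arbitrary chart
      around the point, and has to be moved to [rho] ([divergME]). This is the
      Piola identity for the transition map ([piola]), which rests on the
      symmetry of second derivatives ([derive_comm]) and on the derivative of
      the determinant ([derive_det]).

    - Riemannian integrals over [U] become integrals over [O] with the density
      [s] ([ge0_integral_density], [Rintegral_density]), by approximation with
      simple functions.

    - The closed operators are given by their weak graphs, so test functions and
      test fields have to correspond. Test functions do by composition with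
      [rho] and test fields by [F = s X]; a function or a field which is smooth
      in the chart [rho] is smooth in all charts because the transitions are
      ([chart_CkM], [chart_CkTM]).

    - The weight [mu] is only positive almost everywhere. It is positive at every
      point of [O] because it is continuous there and the metric is invertible
      ([weight_gt0]). *)

(** * C^k functions on open subsets of R^d *)

Section Local.
Context {R : realType}.

Lemma near_eq_continuous (S T : topologicalType) (f g : S -> T) x :
  {near x, f =1 g} -> {for x, continuous f} -> {for x, continuous g}.
Proof.
move=> fg cf; rewrite /prop_for /continuous_at -(nbhs_singleton fg).
by apply: cvg_trans cf; apply: near_eq_cvg.
Qed.

Lemma near_eq_differentiable (V V' : normedModType R) (f g : V -> V') x :
  {near x, f =1 g} -> differentiable f x ->
  differentiable g x /\ 'd g x = 'd f x :> (V -> V').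
Proof.
move=> fg /diff_locallyP[cdf dfE].
have gE : g \o shift x = cst (g x) + 'd f x +o_ 0 id.
  apply/eqaddoP => e e0.
  have /eqaddoP/(_ e e0) H := dfE.
  have fg' : \forall h \near (0 : V), f (h + x) = g (h + x).
    have := near_shift 0 x (fun y => f y = g y); rewrite subr0 => <-.
    exact: fg.
  near=> h.
  have Hh : `|(f \o shift x - (cst (f x) + 'd f x)) h| <= e * `|h|.
    by near: h; exact: H.
  have fgh : f (h + x) = g (h + x) by near: h; exact: fg'.
  by move: Hh; rewrite !fctE /= fgh (nbhs_singleton fg).
have dg : 'd g x = 'd f x :> (V -> V') by apply: diff_unique.
split; last exact: dg.
by apply/diff_locallyP; rewrite dg; split; [exact: cdf|exact: gE].
Unshelve. all: by end_near. Qed.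

End Local.

Section Calculus.
Context {R : realType} {d : nat}.
Local Notation E := 'rV[R]_d.

Lemma nbhs_in_open (T : topologicalType) (O : set T) (P : T -> Prop) x :
  open O -> O x -> (forall y, O y -> P y) -> \forall y \near x, P y.
Proof. by move=> oO Ox OP; apply: filterS (open_nbhs_nbhs (conj oO Ox)). Qed.

(** The classes [Ck] only see the values on the open set, so that any function
    can be replaced by another expression valid there. *)
Lemma Ck_ext k (O : set E) (f g : E -> R) : open O ->
  (forall x, O x -> f x = g x) -> Ck k O f -> Ck k O g.
Proof.
move=> oO; elim: k f g => [|k IH] f g fg /=.
  move=> cf x Ox; apply: near_eq_continuous (cf x Ox).
  exact: nbhs_in_open fg.
move=> [df Df]; split=> [x Ox|v].
  have nfg : {near x, f =1 g} by exact: nbhs_in_open fg.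
  by have [] := near_eq_differentiable nfg (df x Ox).
apply: (IH (fun x => 'D_v f x)) => // x Ox.
apply: near_eq_derive; exact: nbhs_in_open fg.
Qed.

Lemma Ck_sub k (O O' : set E) (f : E -> R) : O' `<=` O ->
  Ck k O f -> Ck k O' f.
Proof.
move=> sO; elim: k f => [|k IH] f /=; first by move=> cf x /sO; exact: cf.
by move=> [df Df]; split=> [x /sO|v]; [exact: df|exact: IH].
Qed.

Lemma CkW k (O : set E) (f : E -> R) : Ck k.+1 O f -> Ck k O f.
Proof.
elim: k f => [|k IH] f [df Df].
  by move=> x Ox; apply: differentiable_continuous; exact: df.
by split=> // v; apply: IH.
Qed.

Lemma Ck_continuous k (O : set E) (f : E -> R) : Ck k O f ->
  forall x, O x -> {for x, continuous f}.
Proof. by elim: k f => // k IH f /CkW; apply: IH. Qed.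

Lemma Ck_cst k (O : set E) (a : R) : Ck k O (fun=> a).
Proof.
elim: k a => [|k IH] a /=; first by move=> x _; exact: cst_continuous.
split=> [x _|v]; first exact: differentiable_cst.
rewrite (_ : 'D_v (fun=> a) = (fun=> 0)) //.
by apply/funext => x; exact: derive_cst.
Qed.

Lemma Ck_add k (O : set E) (f g : E -> R) : open O ->
  Ck k O f -> Ck k O g -> Ck k O (fun x => f x + g x).
Proof.
move=> oO; elim: k f g => [|k IH] f g /=.
  by move=> cf cg x Ox; apply: continuousD; [exact: cf|exact: cg].
move=> [df Df] [dg Dg]; split=> [x Ox|v].
  by apply: differentiableD; [exact: df|exact: dg].
apply: (Ck_ext oO _ (IH _ _ (Df v) (Dg v))) => x Ox.
by rewrite [RHS]deriveD //; apply: diff_derivable; [exact: df|exact: dg].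
Qed.

Lemma Ck_mul k (O : set E) (f g : E -> R) : open O ->
  Ck k O f -> Ck k O g -> Ck k O (fun x => f x * g x).
Proof.
move=> oO; elim: k f g => [|k IH] f g.
  by move=> cf cg x Ox; apply: continuousM; [exact: cf|exact: cg].
move=> cf cg; have [df Df] := cf; have [dg Dg] := cg; split=> [x Ox|v].
  by apply: differentiableM; [exact: df|exact: dg].
have cD := Ck_add oO (IH _ _ (CkW cf) (Dg v)) (IH _ _ (CkW cg) (Df v)).
apply: (Ck_ext oO _ cD) => x Ox.
rewrite [RHS]deriveM //; apply: diff_derivable; [exact: df|exact: dg].
Qed.

Lemma Ck_opp k (O : set E) (f : E -> R) : open O ->
  Ck k O f -> Ck k O (fun x => - f x).
Proof.
move=> oO cf; apply: (Ck_ext oO _ (Ck_mul oO (@Ck_cst k O (-1)) cf)) => x _.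
by rewrite mulN1r.
Qed.

Lemma Ck_sum k (I : Type) (r : seq I) (P : pred I) (O : set E) (f : I -> E -> R) :
  open O -> (forall i, P i -> Ck k O (f i)) ->
  Ck k O (fun x => \sum_(i <- r | P i) f i x).
Proof.
move=> oO cf; elim: r => [|i r IH].
  by apply: (Ck_ext oO _ (@Ck_cst k O 0)) => x _; rewrite big_nil.
have [Pi|nPi] := boolP (P i).
  apply: (Ck_ext oO _ (Ck_add oO (cf i Pi) IH)) => x _.
  by rewrite big_cons Pi.
by apply: (Ck_ext oO _ IH) => x _; rewrite big_cons (negbTE nPi).
Qed.

Lemma Ck_prod k (I : Type) (r : seq I) (P : pred I) (O : set E) (f : I -> E -> R) :
  open O -> (forall i, P i -> Ck k O (f i)) ->
  Ck k O (fun x => \prod_(i <- r | P i) f i x).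
Proof.
move=> oO cf; elim: r => [|i r IH].
  by apply: (Ck_ext oO _ (@Ck_cst k O 1)) => x _; rewrite big_nil.
have [Pi|nPi] := boolP (P i).
  apply: (Ck_ext oO _ (Ck_mul oO (cf i Pi) IH)) => x _.
  by rewrite big_cons Pi.
by apply: (Ck_ext oO _ IH) => x _; rewrite big_cons (negbTE nPi).
Qed.

(** By induction on [k]: the derivative of [1 / f] is [- (1 / f)^2 f'], where
    [1 / f] is already known to be one class lower. *)
Lemma Ck_inv k (O : set E) (f : E -> R) : open O ->
  (forall x, O x -> f x != 0) -> Ck k O f -> Ck k O (fun x => (f x)^-1).
Proof.
move=> oO f0; elim: k => [|k IH] cf.
  by move=> x Ox; apply: continuousV; [exact: f0|exact: cf].
have [df Df] := cf; split=> [x Ox|v].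
  by apply: differentiableV; [exact: df|exact: f0].
have cV := IH (CkW cf).
apply: (Ck_ext oO _ (Ck_opp oO (Ck_mul oO (Ck_mul oO cV cV) (Df v)))) => x Ox.
rewrite [RHS]deriveV ?f0 //; last by apply: diff_derivable; exact: df.
by rewrite -exprVn expr2 -mulNr.
Qed.

(** As for the inverse, since the derivative of the square root of [f] is
    [f' / (2 sqrt f)]. *)
Lemma Ck_sqrt k (O : set E) (f : E -> R) : open O ->
  (forall x, O x -> 0 < f x) -> Ck k O f -> Ck k O (fun x => Num.sqrt (f x)).
Proof.
move=> oO f0; elim: k => [|k IH] cf.
  move=> x Ox; apply: (@continuous_comp _ _ _ f (@Num.sqrt R)); first exact: cf.
  exact: sqrt_continuous.
have dsqrt x : O x -> is_derive (f x) 1 (@Num.sqrt R) (2 * Num.sqrt (f x))^-1.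
  by move=> Ox; apply: is_derive1_sqrt; exact: f0.
have dfsqrt x : O x -> differentiable (@Num.sqrt R) (f x).
  by move=> /dsqrt[] /derivable1_diffP.
have [df Df] := cf; split=> [x Ox|v].
  by apply: (@differentiable_comp _ _ _ _ f); [exact: df|exact: dfsqrt].
have s0 x : O x -> Num.sqrt (f x) != 0.
  by move=> /f0; rewrite -sqrtr_gt0 => /lt0r_neq0.
have cV := Ck_inv oO s0 (IH (CkW cf)).
apply: (Ck_ext oO _ (Ck_mul oO (Ck_mul oO (@Ck_cst k O 2^-1) cV) (Df v))) => x Ox.
rewrite [RHS]deriveE; last first.
  by apply: (@differentiable_comp _ _ _ _ f); [exact: df|exact: dfsqrt].
rewrite (diff_comp (df x Ox) (dfsqrt x Ox)) [RHS]/= -(deriveE v (df x Ox)).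
rewrite deriv1E; last by have [] := dsqrt x Ox.
rewrite derive1E (@derive_val _ _ _ _ _ _ _ (dsqrt x Ox)) /= invfM.
by rewrite /GRing.scale /= mulrC.
Qed.

Lemma differentiable_row (V : normedModType R) (T : V -> E) x :
  (forall i, differentiable (fun y => T y 0 i) x) -> differentiable T x.
Proof.
move=> dT; rewrite (_ : T = \sum_(i < d) (fun y => T y 0 i *: delta_mx 0 i)).
  by apply: differentiable_sum => i; exact: differentiableZl.
apply/funext => y; rewrite {1}(row_sum_delta (T y)).
by elim/big_rec2: _ => // i a b _ ->.
Qed.

Lemma diff_coord (T : E -> E) x v i : differentiable T x ->
  'd T x v 0 i = 'D_v (fun y => T y 0 i) x.
Proof.
move=> dT; rewrite -deriveE // derive_mx ?mxE //; exact: diff_derivable.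
Qed.

Lemma differentiable_coordinate (V : normedModType R) (T : V -> E) x i :
  differentiable T x -> differentiable (fun y => T y 0 i) x.
Proof.
move=> dT; apply: (@differentiable_comp _ _ _ _ T (fun y => y 0 i)) => //.
exact: differentiable_coord.
Qed.

Lemma derive_coordE (f : E -> R) x v : differentiable f x ->
  'D_v f x = \sum_i v 0 i * 'D_(delta_mx 0 i) f x.
Proof.
move=> df; rewrite deriveE // {1}(row_sum_delta v) linear_sum.
by apply: eq_bigr => i _; rewrite linearZ deriveE.
Qed.

Lemma derive_comp_coord (f : E -> R) (T : E -> E) x v :
  differentiable T x -> differentiable f (T x) ->
  'D_v (fun y => f (T y)) x =
  \sum_i 'D_v (fun y => T y 0 i) x * 'D_(delta_mx 0 i) f (T x).
Proof.
move=> dT df; rewrite deriveE; last exact: (differentiable_comp dT df).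
rewrite (diff_comp dT df) /= -deriveE // derive_coordE //.
by apply: eq_bigr => i _; rewrite diff_coord.
Qed.

Lemma continuous_row (S : topologicalType) (T : S -> E) x :
  (forall i, {for x, continuous (fun y => T y 0 i)}) -> {for x, continuous T}.
Proof.
move=> cT; apply/cvgrPdist_le => /= e e0; near=> y.
rewrite /Num.Def.normr/= mx_normrE (bigmax_le _ (ltW e0))//= => -[i j] _.
rewrite !mxE/= ord1; move: j; near: y; apply: filter_forall => j.
exact: (cvgrPdist_le _ _).1 (cT j) _ e0.
Unshelve. all: by end_near. Qed.

Lemma Ck_row_continuous k (O : set E) (T : E -> E) :
  (forall i, Ck k O (fun x => T x 0 i)) ->
  forall x, O x -> {for x, continuous T}.
Proof. by move=> cT x Ox; apply: continuous_row => i; apply: Ck_continuous Ox. Qed.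

Lemma Ck_row_differentiable k (O : set E) (T : E -> E) :
  (forall i, Ck k.+1 O (fun x => T x 0 i)) ->
  forall x, O x -> differentiable T x.
Proof. by move=> cT x Ox; apply: differentiable_row => i; apply: (cT i).1. Qed.

(** By induction on [k], from the chain rule in coordinates: the derivatives of
    the composition are sums of products of derivatives of the components of
    [T] with partial derivatives of [f] composed with [T]. *)
Lemma Ck_comp k (O O' : set E) (f : E -> R) (T : E -> E) : open O ->
  (forall x, O x -> O' (T x)) ->
  (forall i, Ck k O (fun x => T x 0 i)) -> Ck k O' f ->
  Ck k O (fun x => f (T x)).
Proof.
move=> oO OT; elim: k f => [|k IH] f cT cf.
  move=> x Ox; apply: (@continuous_comp _ _ _ T f); last exact/cf/OT.
  exact: Ck_row_continuous cT _ Ox.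
have dT := Ck_row_differentiable cT.
have [df Df] := cf; split=> [x Ox|v].
  by apply: (@differentiable_comp _ _ _ _ T f); [exact: dT|exact/df/OT].
have cD : Ck k O (fun x => \sum_i 'D_v (fun y => T y 0 i) x *
                            'D_(delta_mx 0 i) f (T x)).
  apply: Ck_sum => // i _; apply: Ck_mul => //; first exact: (cT i).2.
  by apply: (IH ('D_(delta_mx 0 i) f)); [move=> j; exact/CkW/cT|exact: Df].
apply: (Ck_ext oO _ cD) => x Ox.
by rewrite -derive_comp_coord //; [exact: dT|exact/df/OT].
Qed.

End Calculus.

(** * The derivative of a determinant *)

Section Determinant.
Context {R : realType} {d : nat}.
Local Notation E := 'rV[R]_d.

Lemma Ck_det n k (O : set E) (A : E -> 'M[R]_n) : open O ->
  (forall i j, Ck k O (fun x => A x i j)) -> Ck k O (fun x => \det (A x)).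
Proof.
move=> oO cA; apply: Ck_sum => // s _; apply: Ck_mul => //; first exact: Ck_cst.
exact: Ck_prod.
Qed.

Lemma derivable_prod (I : Type) (r : seq I) (f : I -> E -> R) x v :
  (forall i, derivable (f i) x v) ->
  derivable (fun y => \prod_(i <- r) f i y) x v.
Proof.
move=> df; elim: r => [|a r IH].
  rewrite (_ : (fun y => _) = cst 1); first exact: derivable_cst.
  by apply/funext => y; rewrite big_nil.
rewrite (_ : (fun y => _) = f a * (fun y => \prod_(i <- r) f i y)).
  by apply: derivableM; [exact: df|exact: IH].
by apply/funext => y; rewrite big_cons.
Qed.

Lemma derive_prod (I : eqType) (r : seq I) (f : I -> E -> R) x v : uniq r ->
  (forall i, derivable (f i) x v) ->
  'D_v (fun y => \prod_(i <- r) f i y) x =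
  \sum_(k <- r) 'D_v (f k) x * \prod_(i <- r | i != k) f i x.
Proof.
move=> + df; elim: r => [|a r IH].
  rewrite big_nil (_ : (fun y => _) = cst 1) ?derive_cst //.
  by apply/funext => y; rewrite big_nil.
move=> /= /andP[ar ur].
rewrite (_ : (fun y => _) = f a * (fun y => \prod_(i <- r) f i y)); last first.
  by apply/funext => y; rewrite big_cons.
rewrite deriveM //; last exact: derivable_prod.
rewrite IH // !big_cons eqxx /= addrC /GRing.scale /=; congr (_ + _).
  rewrite mulrC; congr (_ * _); rewrite big_seq_cond [RHS]big_seq_cond.
  apply: eq_bigl => i; rewrite andbT; case: (boolP (i \in r)) => //= ir.
  by apply/esym; apply: contraNneq ar => <-.
rewrite big_distrr /= big_seq [RHS]big_seq; apply: eq_bigr => i ir.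
rewrite big_cons ifT; first by rewrite mulrCA.
by apply: contraNneq ar => ->.
Qed.

(** Differentiating the Leibniz expansion one row at a time yields the sum over
    [k] of the determinants whose row [k] is differentiated; expanding each of
    them along that row brings out the adjugate. *)
Lemma derive_det n (A : E -> 'M[R]_n) x v :
  (forall i j, derivable (fun y => A y i j) x v) ->
  'D_v (fun y => \det (A y)) x =
  \tr ((\matrix_(i, j) 'D_v (fun y => A y i j) x) *m \adj (A x)).
Proof.
move=> dA.
have dprod (s : {perm 'I_n}) : derivable (fun y => \prod_i A y i (s i)) x v.
  by apply: derivable_prod => i.
transitivity (\sum_(s : {perm 'I_n}) (-1) ^+ s * 'D_v (fun y => \prod_i A y i (s i)) x).
  rewrite (_ : (fun y => _) = \sum_(s : {perm 'I_n}) (fun y => (-1) ^+ s *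
                                  \prod_i A y i (s i))); last first.
    apply/funext => y; rewrite /determinant.
    by elim/big_rec2: _ => // i a b _ ->.
  have key (r : seq {perm 'I_n}) : is_derive x v
     (\sum_(s <- r) (fun y => (-1) ^+ s * \prod_i A y i (s i)))
     (\sum_(s <- r) (-1) ^+ s * 'D_v (fun y => \prod_i A y i (s i)) x).
    elim: r => [|s r IH]; first by rewrite !big_nil; exact: is_derive_cst.
    rewrite !big_cons; apply: is_deriveD.
    apply: DeriveDef; last by rewrite deriveMl.
    by apply: derivableM => //; exact: derivable_cst.
  by have [_ ->] := key (index_enum _).
transitivity (\sum_k \det (\matrix_(i, j) if i == k then 'D_v (fun y => A y i j) x
                             else A x i j)).
  rewrite exchange_big /=; apply: eq_bigr => s _.
  rewrite derive_prod ?index_enum_uniq // big_distrr /=.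
  apply: eq_bigr => k _; rewrite [in RHS](bigD1 k) //= !mxE eqxx; congr (_ * (_ * _)).
  by apply: eq_bigr => i /negbTE ik; rewrite !mxE ik.
apply: eq_bigr => k _; rewrite (expand_det_row _ k) !mxE.
apply: eq_bigr => j _; rewrite !mxE eqxx; congr (_ * (_ * \det _)).
by apply/matrixP => a b; rewrite !mxE eq_sym (negbTE (neq_lift _ _)).
Qed.

End Determinant.

(** * Symmetry of second derivatives *)

Section Schwarz.
Context {R : realType} {d : nat}.
Local Notation E := 'rV[R]_d.

Lemma is_derive_line (f : E -> R) (u y : E) (t : R) :
  differentiable f (t *: u + y) ->
  is_derive t 1 (fun s : R => f (s *: u + y)) ('D_u f (t *: u + y)).
Proof.
move=> df.
have dl : is_diff t (fun s : R => s *: u + y) ( *:%R^~ u).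
  by apply: is_diff_eq; apply/funext => s; rewrite !fctE addr0.
have [dl1 dl2] := dl.
have dc := differentiable_comp dl1 df.
apply: DeriveDef; first exact: diff_derivable.
by rewrite deriveE // (diff_comp dl1 df) /= dl2 scale1r deriveE.
Qed.

(** The mean value theorem in the direction [u] reduces the second difference
    to an increment of ['D_u f] along [h *: v], which differentiability of
    ['D_u f] at [x] estimates. *)
Lemma second_difference (f : E -> R) (u v x : E) (e : R) : 0 < e ->
  (\forall y \near x, differentiable f y) -> differentiable ('D_u f) x ->
  exists2 r : R, 0 < r & forall h, 0 < h -> h < r ->
    `|f (h *: u + (h *: v + x)) - f (h *: u + x) - f (h *: v + x) + f x
      - h ^+ 2 * 'D_v ('D_u f) x| <= h ^+ 2 * e.
Proof.
move=> e0 df dDf.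
set N := `|u| + `|v| + 1.
have N0 : 0 < N by rewrite ltr_wpDl// addr_ge0.
(* the remainder of ['D_u f] is used at two points of norm at most [h * N] *)
have e'0 : 0 < e / (2 * N) by rewrite divr_gt0// mulr_gt0.
have /eqaddoP/(_ _ e'0) Hdf := diff_locally dDf.
have df' : \forall w \near (0 : E), differentiable f (w + x).
  have := near_shift 0 x (fun y => differentiable f y); rewrite subr0 => <-.
  exact: df.
have /nbhs_normP[r /= r0 Hr] : \forall w \near (0 : E), differentiable f (w + x) /\
   `|'D_u f (w + x) - ('D_u f x + 'd ('D_u f) x w)| <= e / (2 * N) * `|w|.
  by near=> w; split; near: w.
exists (r / N) => [|h h0 hr]; first by rewrite divr_gt0.
have hN : h * N < r by rewrite -ltr_pdivlMr.
have small (t s : R) : 0 <= t <= h -> 0 <= s <= h ->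
    `|t *: u + s *: v| <= h * N /\ ball_ Num.norm 0 r (t *: u + s *: v).
  move=> /andP[t0 th] /andP[s0 sh].
  have le : `|t *: u + s *: v| <= h * N.
    rewrite (le_trans (ler_normD _ _))// !normrZ !ger0_norm//.
    rewrite /N !mulrDr mulr1 -addrA lerD ?ler_wpM2r//.
    by rewrite ler_wpDr ?ler_wpM2r// ltW.
  by split=> //; rewrite /ball_ /= sub0r normrN (le_lt_trans le).
pose phi (t : R) := f (t *: u + (h *: v + x)) - f (t *: u + x).
pose dphi (t : R) := 'D_u f (t *: u + (h *: v + x)) - 'D_u f (t *: u + x).
have hh : 0 <= h <= h by rewrite lexx ltW.
have h00 : 0 <= (0 : R) <= h by rewrite lexx ltW.
have dphiP t : 0 <= t <= h -> is_derive t 1 phi (dphi t).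
  move=> th; apply: is_deriveB; apply: is_derive_line.
    by rewrite addrA; have [_ /Hr[]] := small t h th hh.
  by have [_ /Hr[]] := small t 0 th h00; rewrite scale0r addr0.
have [c /[!in_itv]/= /andP[c0 ch]] :
    exists2 c, c \in `]0, h[%R & phi h - phi 0 = dphi c * (h - 0).
  apply: MVT => //.
    by move=> t /[!in_itv]/= /andP[t0 th]; apply: dphiP; rewrite !ltW.
  apply: derivable_within_continuous => t /[!in_itv]/= th.
  by have [] := dphiP t th.
have cc : 0 <= c <= h by rewrite !ltW.
rewrite subr0 /phi !scale0r !add0r => E1.
rewrite (_ : _ - _ + f x = dphi c * h); last first.
  by rewrite -E1; ring.
have [b1 /Hr[_]] := small c h cc hh.
have [b2 /Hr[_]] := small c 0 cc h00.
rewrite scale0r addr0 in b2 *.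
rewrite -addrA => H2 H1.
rewrite expr2 -!mulrA [dphi c * h]mulrC -mulrBr normrM gtr0_norm// ler_pM2l//.
have dE : 'd ('D_u f) x (c *: u + h *: v) - 'd ('D_u f) x (c *: u) =
    h * 'D_v ('D_u f) x.
  by rewrite linearD addrAC subrr add0r linearZ deriveE.
rewrite -dE /dphi; set a := 'D_u f (c *: u + (_ + _)) in H1 *.
set b := 'D_u f (c *: u + x) in H2 *.
rewrite (_ : a - b - _ = (a - ('D_u f x + 'd ('D_u f) x (c *: u + h *: v))) -
   (b - ('D_u f x + 'd ('D_u f) x (c *: u)))); last first.
  by rewrite !opprD !opprK !addrA; ring.
rewrite (le_trans (ler_normB _ _))// (le_trans (lerD H1 H2))//.
rewrite -mulrDr; apply: (le_trans (ler_wpM2l (ltW e'0) (lerD b1 b2))).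
have -> // : e / (2 * N) * (h * N + h * N) = h * e.
by field; rewrite gt_eqF.
Unshelve. all: by end_near. Qed.

(** The second difference is symmetric in [u] and [v], and both iterated
    derivatives are limits of its quotient by [h ^+ 2]. *)
Lemma derive_comm (f : E -> R) (u v x : E) :
  (\forall y \near x, differentiable f y) ->
  differentiable ('D_u f) x -> differentiable ('D_v f) x ->
  'D_v ('D_u f) x = 'D_u ('D_v f) x.
Proof.
move=> df du dv; apply/eqP; rewrite -subr_eq0 -normr_le0; apply/ler_addgt0Pl => e e0.
rewrite addr0.
have e20 : 0 < e / 2 by rewrite divr_gt0.
have [r r0 Hr] := second_difference v e20 df du.
have [s s0 Hs] := second_difference u e20 df dv.
pose h := Num.min r s / 2.
have m0 : 0 < Num.min r s by rewrite lt_min r0.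
have h0 : 0 < h by rewrite divr_gt0.
have hm : h < Num.min r s by rewrite ltr_pdivrMr// ltr_pMr// ltr1n.
have := hm; rewrite lt_min => /andP[hr hs].
have H1 := Hr h h0 hr; have H2 := Hs h h0 hs.
have h20 : 0 < h ^+ 2 by rewrite exprn_gt0.
rewrite -(ler_pM2l h20) -[X in X * `|_|]gtr0_norm// -normrM.
rewrite (addrCA (h *: v)) in H2.
set a := 'D_v _ x in H1 *; set b := 'D_u ('D_v f) x in H2 *.
set F := f _ in H1 H2; set F1 := f (_ + x) in H1 H2; set F2 := f (_ + x) in H1 H2.
rewrite (_ : h ^+ 2 * (a - b) = (F - F2 - F1 + f x - h ^+ 2 * b) -
   (F - F1 - F2 + f x - h ^+ 2 * a)); last by ring.
by rewrite (le_trans (ler_normB _ _))// (le_trans (lerD H2 H1))// -mulrDr -splitr.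
Qed.

End Schwarz.

(** * The Piola identity *)

Section Piola.
Context {R : realType} {d : nat}.
Local Notation E := 'rV[R]_d.

Lemma derive_sum_fun (h : 'I_d -> E -> R) (x v : E) :
  (forall i, derivable (h i) x v) ->
  'D_v (fun y => \sum_i h i y) x = \sum_i 'D_v (h i) x.
Proof.
move=> dh; rewrite -derive_sum //; congr ('D_v _ x).
by apply/funext => y; rewrite fct_sumE.
Qed.

Lemma jacobianE (T : E -> E) x i j : differentiable T x ->
  jacobian T x i j = 'D_(delta_mx 0 i) (fun y => T y 0 j) x.
Proof. by move=> dT; rewrite mxE diff_coord. Qed.

Lemma diff_jacobian (T : E -> E) x v : 'd T x v = v *m jacobian T x.
Proof. by rewrite /jacobian mul_rV_lin1. Qed.

Lemma Ck_jacobian k (O : set E) (T : E -> E) i j : open O ->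
  (forall i, Ck k.+1 O (fun x => T x 0 i)) ->
  Ck k O (fun x => jacobian T x i j).
Proof.
move=> oO cT; apply: (Ck_ext oO _ ((cT j).2 (delta_mx 0 i))) => x Ox.
by rewrite jacobianE; last exact: Ck_row_differentiable cT _ Ox.
Qed.

Lemma divergE (F : E -> E) x : differentiable F x ->
  diverg F x = \tr (jacobian F x).
Proof. by move=> dF; apply: eq_bigr => i _; rewrite jacobianE. Qed.

Lemma near_eq_diverg (F G : E -> E) x : {near x, F =1 G} ->
  diverg F x = diverg G x.
Proof.
move=> FG; apply: eq_bigr => i _; apply: near_eq_derive.
by apply: filterS FG => y ->.
Qed.

Lemma diverg_scale (a : E -> R) (F : E -> E) x : differentiable a x ->
  differentiable F x ->
  diverg (fun y => a y *: F y) x = a x * diverg F x + 'D_(F x) a x.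
Proof.
move=> da dF; rewrite derive_coordE // /diverg mulr_sumr -big_split /=.
apply: eq_bigr => i _.
rewrite (_ : (fun y => _) = a * (fun y => F y 0 i)); last first.
  by apply/funext => y; rewrite mxE.
by rewrite deriveM //; apply: diff_derivable => //; exact: differentiable_coordinate.
Qed.

Lemma trace_adj (F : comNzRingType) n (A B C D : 'M[F]_n) :
  A *m B = C *m A + D ->
  \det A * \tr C + \tr (D *m \adj A) = \det A * \tr B.
Proof.
move=> key; rewrite -[in RHS]mxtraceZ -mul_scalar_mx -mul_adj_mx -mulmxA key.
rewrite [RHS]mxtrace_mulC mulmxDl mxtraceD -mulmxA mul_mx_adj.
by rewrite mul_mx_scalar mxtraceZ.
Qed.

(** Differentiating [Z \o T = V J] gives [J DZ = DV J + D_V J], where the symmetry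
    of the second derivatives of [T] turns the derivative of [J] in each
    direction, applied to [V], into the derivative [D_V J] of [J] along [V].
    Taking traces against the adjugate of [J] leaves [det J tr DV] plus the
    derivative of [det J] along [V], which is the divergence of [det J V]. *)
Lemma piola (O : set E) (T V Z : E -> E) x : open O -> O x ->
  (forall i, Ck 2 O (fun y => T y 0 i)) ->
  differentiable V x -> differentiable Z (T x) ->
  {near x, (fun y => Z (T y)) =1 (fun y => V y *m jacobian T y)} ->
  diverg (fun y => \det (jacobian T y) *: V y) x =
  \det (jacobian T x) * diverg Z (T x).
Proof.
move=> oO Ox cT dV dZ ZV.
have dT y : O y -> differentiable T y by exact: Ck_row_differentiable cT _.
have cJ i j : Ck 1 O (fun y => jacobian T y i j) by exact: Ck_jacobian.
have dJ i j : differentiable (fun y => jacobian T y i j) x by exact: (cJ i j).1.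
have ddet : differentiable (fun y => \det (jacobian T y)) x.
  have cdet : Ck 1 O (fun y => \det (jacobian T y)) by exact: Ck_det.
  exact: cdet.1 x Ox.
set DJ := \matrix_(i, j) 'D_(V x) (fun y => jacobian T y i j) x.
have key : jacobian T x *m jacobian Z (T x) = jacobian V x *m jacobian T x + DJ.
  apply/matrixP => k j; rewrite mxE.
  transitivity ('D_(delta_mx 0 k) (fun y => Z (T y) 0 j) x).
    rewrite (@derive_comp_coord _ _ (fun y => Z y 0 j)).
    - apply: eq_bigr => l _; congr (_ * _).
        exact: jacobianE (dT x Ox).
      exact: jacobianE dZ.
    - exact: dT.
    - exact: differentiable_coordinate.
  transitivity ('D_(delta_mx 0 k) (fun y => \sum_m V y 0 m * jacobian T y m j) x).
    by apply: near_eq_derive; apply: filterS ZV => y ->; rewrite mxE.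
  rewrite derive_sum_fun; last first.
    move=> m; apply: diff_derivable.
    by apply: differentiableM => //; exact: differentiable_coordinate.
  rewrite !mxE derive_coordE // -big_split /=; apply: eq_bigr => m _.
  rewrite [LHS]deriveM; last 2 first.
    by apply: diff_derivable; exact: differentiable_coordinate.
    by apply: diff_derivable.
  rewrite [RHS]addrC [X in _ = _ + X]mulrC; congr (_ + _); last first.
    congr (_ * _); exact/esym/jacobianE.
  congr (_ * _).
  have nJ a b : {near x, (fun y => jacobian T y a b) =1
                         'D_(delta_mx 0 a) (fun y => T y 0 b)}.
    by apply: nbhs_in_open oO Ox _ => y Oy; rewrite (jacobianE _ _ (dT y Oy)).
  rewrite (near_eq_derive _ (nJ _ _)) (near_eq_derive _ (nJ _ _)).
  apply: derive_comm.
  - by apply: nbhs_in_open oO Ox _ => y; apply: (cT j).1.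
  - by apply: ((cT j).2 _).1.
  - by apply: ((cT j).2 _).1.
rewrite (diverg_scale ddet dV) derive_det; last by move=> i j; exact: diff_derivable.
rewrite (divergE dV) (divergE dZ).
exact: trace_adj key.
Qed.

End Piola.

(** * Integration against a measure with a density *)

Section ChangeOfVariables.
Context {d1 d2 : measure_display} {X : measurableType d1}
  {Y : measurableType d2} {R : realType}.
Variables (m1 : {measure set X -> \bar R}) (m2 : {measure set Y -> \bar R}).
Variables (D1 : set X) (D2 : set Y) (phi : X -> Y) (s : X -> R).
Hypotheses (mD1 : measurable D1) (mD2 : measurable D2).
Hypothesis mphi : measurable_fun D1 phi.
Hypothesis phiD : forall x, D1 x -> D2 (phi x).
Hypotheses (ms : measurable_fun D1 s) (s0 : forall x, D1 x -> 0 <= s x).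
Hypothesis m2E : forall A, measurable A -> A `<=` D2 ->
  m2 A = (\int[m1]_(x in D1 `&` phi @^-1` A) (s x)%:E)%E.

Import HBNNSimple.

Lemma measurable_comp_in (f : Y -> R) :
  measurable_fun D2 f -> measurable_fun D1 (fun x => f (phi x)).
Proof.
by move=> mf; apply: (measurable_comp mD2 _ mf mphi) => _ [x D1x <-]; exact: phiD.
Qed.

Lemma integral_density_indic (A : set Y) (k : R) : 0 <= k -> measurable A ->
  (\int[m2]_(y in D2) (k * \1_A y)%:E =
   \int[m1]_(x in D1) (k * \1_A (phi x) * s x)%:E)%E.
Proof.
move=> k0 mA.
have mi : measurable_fun D1 (fun x => \1_A (phi x) : R).
  by apply: measurable_comp_in; exact: measurable_indic.
under eq_integral do rewrite EFinM.
rewrite ge0_integralZl_EFin//; last first.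
  by apply/measurable_EFinP; exact: measurable_indic.
rewrite integral_indic// m2E; [|exact: measurableI|by move=> y []].
under [in RHS]eq_integral do rewrite -mulrA EFinM.
rewrite ge0_integralZl_EFin//; last 2 first.
  by move=> x Dx; rewrite lee_fin mulr_ge0//; exact: s0.
  by apply/measurable_EFinP; exact: measurable_funM.
congr (_ * _)%E.
rewrite (_ : D1 `&` _ = D1 `&` phi @^-1` A); last first.
  apply/seteqP; split=> x [D1x] /= => [[? ?]|?]; split=> //; split=> //.
  exact: phiD.
rewrite integral_mkcondr; apply: eq_integral => x _.
rewrite /patch indicE (_ : (x \in _) = (phi x \in A)).
  by case: (phi x \in A); rewrite ?mul1r ?mul0r.
by apply/idP/idP; rewrite !inE.
Qed.

(** Both sides are limits along the same sequence of simple functions, for which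
    the equality is the hypothesis on the measures of sets. *)
Lemma ge0_integral_density (f : Y -> \bar R) : measurable_fun D2 f ->
  (forall y, D2 y -> 0 <= f y)%E ->
  (\int[m2]_(y in D2) f y = \int[m1]_(x in D1) (f (phi x) * (s x)%:E))%E.
Proof.
move=> mf f0; pose f_ := nnsfun_approx mD2 mf.
have mf_ n : measurable_fun D1 (fun x => f_ n (phi x)).
  by apply: measurable_comp_in; exact: measurable_funTS.
transitivity (limn (fun n => \int[m2]_(y in D2) (f_ n y)%:E))%E.
  rewrite -monotone_convergence//.
  - apply: eq_integral => y /[!inE] yD; apply/esym/cvg_lim => //.
    exact: cvg_nnsfun_approx.
  - by move=> n; apply/measurable_EFinP; exact: measurable_funTS.
  - by move=> n y _; rewrite lee_fin.
  - by move=> y _ m n mn; rewrite lee_fin; exact/lefP/nd_nnsfun_approx.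
transitivity (limn (fun n => \int[m1]_(x in D1) (f_ n (phi x) * s x)%:E))%E;
    last first.
  rewrite -monotone_convergence//.
  - apply: eq_integral => x /[!inE] D1x; apply/cvg_lim => //.
    under eq_fun do rewrite EFinM.
    apply: cvgeZr => //.
    by apply: cvg_nnsfun_approx => //; exact: phiD.
  - by move=> n; apply/measurable_EFinP; exact: measurable_funM.
  - by move=> n x D1x; rewrite lee_fin mulr_ge0//; exact: s0.
  - move=> x D1x m n mn; rewrite lee_fin ler_wpM2r//; first exact: s0.
    exact/lefP/nd_nnsfun_approx.
congr (limn _); apply/funext => n.
have mpre k : measurable (f_ n @^-1` [set k]).
  by rewrite -[X in measurable X]setTI; exact: measurable_funP.
transitivity (\sum_(k \in range (f_ n))
    \int[m2]_(y in D2) (k * \1_(f_ n @^-1` [set k]) y)%:E)%E.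
  under eq_integral do rewrite fimfunE -fsumEFin//.
  rewrite ge0_integral_fsum//.
  - by move=> r; apply/measurable_EFinP; apply: measurable_funM => //;
      exact: measurable_indic.
  - by move=> r y _; rewrite EFinM nnfun_muleindic_ge0.
transitivity (\sum_(k \in range (f_ n))
    \int[m1]_(x in D1) (k * \1_(f_ n @^-1` [set k]) (phi x) * s x)%:E)%E.
  apply: eq_fsbigr => r /[!inE] -[y _ <-]; apply: integral_density_indic => //.
rewrite -ge0_integral_fsum//.
- apply: eq_integral => x D1x; rewrite fsumEFin//; congr EFin.
  by rewrite fimfunE fsbig_finite//= fsbig_finite//= mulr_suml.
- move=> r; apply/measurable_EFinP; apply: measurable_funM => //.
  apply: measurable_funM => //; apply: measurable_comp_in.
  exact: measurable_indic.
- move=> r x D1x; rewrite EFinM mule_ge0//; last by rewrite lee_fin s0.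
  by rewrite EFinM nnfun_muleindic_ge0.
Qed.

(** The positive and the negative parts are transported separately, whatever
    their integrals. *)
Lemma Rintegral_density (f : Y -> R) : measurable_fun D2 f ->
  \int[m2]_(y in D2) f y = \int[m1]_(x in D1) (f (phi x) * s x).
Proof.
move=> mf; rewrite /Rintegral integralE [in RHS]integralE; congr fine.
have mEf : measurable_fun D2 (EFin \o f) by exact/measurable_EFinP.
rewrite (ge0_integral_density (measurable_funepos mEf)); last first.
  by move=> y _; exact: funepos_ge0.
rewrite (ge0_integral_density (measurable_funeneg mEf)); last first.
  by move=> y _; exact: funeneg_ge0.
congr (_ - _)%E; apply: eq_integral => x /[!inE] D1x.
  by rewrite !funeposE /= EFinM maxe_pMl ?lee_fin ?s0 // mul0e.
rewrite !funenegE maxe_pMl ?lee_fin ?s0 // mul0e; congr maxe.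
exact: (congr1 EFin (mulNr _ _)).
Qed.

End ChangeOfVariables.

(** * Borel sets and Lebesgue measure *)

Section Borel.

Lemma open_borel (T : ptopologicalType) (A : set T) : open A ->
  measurable (A : set (borel T)).
Proof. exact: sub_sigma_algebra. Qed.

Lemma continuous_borel (T U : ptopologicalType) (f : T -> U) (A : set T) :
  open A -> (forall x, A x -> {for x, continuous f}) ->
  measurable_fun (A : set (borel T)) (f : borel T -> borel U).
Proof.
move=> oA cf; apply: (@measurability _ _ (borel T) (borel U) A f open) => //.
move=> _ [B oB <-]; apply: open_borel.
rewrite openE => x [Ax Bfx]; apply: filterI; first exact: open_nbhs_nbhs.
by apply: cf => //; exact: open_nbhs_nbhs.
Qed.

Lemma continuous_measurable (R : realType) (T : ptopologicalType) (f : T -> R)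
    (A : set T) : open A -> (forall x, A x -> {for x, continuous f}) ->
  measurable_fun (A : set (borel T)) (f : borel T -> R).
Proof.
move=> oA cf.
apply: (@measurability _ _ (borel T) _ A f _ (RGenOpens.measurableE R)).
move=> _ [B [a [b ->]] <-]; apply: open_borel.
rewrite openE => x [Ax Bfx]; apply: filterI; first exact: open_nbhs_nbhs.
by apply: cf => //; apply: open_nbhs_nbhs; split=> //; exact: interval_open.
Qed.

End Borel.

Section Lebesgue.
Context {R : realType} {d : nat}.
Local Notation E := 'rV[R]_d.
Variable lam : {measure set (borel E) -> \bar R}.
Hypothesis hlam : is_lebesgue_measure lam.

(** A nonempty open set contains a box of positive volume. *)
Lemma lebesgue_ae_dense (P : E -> Prop) (A : set E) : {ae lam, forall x, P x} ->
  open A -> A !=set0 -> exists2 x, A x & P x.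
Proof.
move=> [N [mN N0 subN]] oA [x Ax].
have /nbhs_ballP[e /= e0 Be] : nbhs x A by exact: open_nbhs_nbhs.
apply: contrapT => nex.
pose a : E := x - const_mx (e / 2); pose b : E := x + const_mx (e / 2).
pose B := [set y : E | forall i, a 0 i <= y 0 i <= b 0 i].
have e2 : 0 < e / 2 by rewrite divr_gt0.
have BA : B `<=` A.
  move=> y By; apply: Be; split=> //= i j; rewrite ord1.
  have := By j; rewrite !mxE => /andP[ay yb].
  rewrite /ball /= ltr_distlC; apply/andP; split.
    by rewrite (lt_le_trans _ ay)// ltrD2l ltrN2 ltr_pdivrMr// ltr_pMr// ltr1n.
  by rewrite (le_lt_trans yb)// ltrD2l ltr_pdivrMr// ltr_pMr// ltr1n.
have BN : B `<=` N.
  by move=> y /BA Ay; apply: subN => Py; apply: nex; exists y.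
have lB : lam B = (\prod_(i < d) (b 0 i - a 0 i))%:E.
  by apply: hlam => i; rewrite !mxE lerD2l (le_trans (y := 0)) ?oppr_le0 ?ltW.
have mB : measurable (B : set (borel E)).
  have -> : B = \bigcap_(i in [set: 'I_d])
      ((fun y : E => y 0 i) @^-1` `[a 0 i, b 0 i]).
    by apply/seteqP; split=> y By i => [_|]; have := By i; rewrite /= in_itv; apply.
  apply: fin_bigcap_measurable => // i _.
  rewrite -[X in measurable X]setTI.
  apply: (@continuous_measurable R _ (fun y : E => y 0 i) setT) => //.
    exact: openT.
  by move=> y _; exact: coord_continuous.
have : (lam B <= lam N)%E by apply: le_measure; rewrite ?inE.
rewrite N0 lB lee_fin leNgt => /negP; apply.
by apply: prodr_gt0 => i _; rewrite !mxE [X in 0 < X](_ : _ = e) //; field.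
Qed.
End Lebesgue.

(** * Charts and tangent vectors *)

Section Charts.
Context {R : realType} {d : nat} (M : manifold R d).
Local Notation E := 'rV[R]_d.
Implicit Types (c : chart R d M) (U : set M).

Lemma atlas_cimg_open c : atlas c -> open (cimg c).
Proof. by case/atlas_chart. Qed.

Lemma atlas_cdom_open c : atlas c -> open (cdom c).
Proof. by case/atlas_chart. Qed.

Lemma cmapK c x : atlas c -> cdom c x -> cinv c (c x) = x.
Proof. by move=> /atlas_chart[_ _ cK _ _]; exact: cK. Qed.

Lemma cimg_cmap c x : cdom c x -> cimg c (c x).
Proof. by move=> cx; exists x. Qed.

Lemma cinvK c p : atlas c -> cimg c p -> cdom c (cinv c p) /\ c (cinv c p) = p.
Proof. by move=> ac [x cx <-]; rewrite cmapK. Qed.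

Lemma cmap_continuous c x : atlas c -> cdom c x -> {for x, continuous c}.
Proof. by move=> /atlas_chart[_ _ _ cc _]; exact: cc. Qed.

Lemma cinv_continuous c p : atlas c -> cimg c p -> {for p, continuous (cinv c)}.
Proof. by move=> /atlas_chart[_ _ _ _ ci]; exact: ci. Qed.

Lemma open_cpreimage c U : atlas c -> open U -> open (cdom c `&` c @^-1` U).
Proof.
move=> ac oU; rewrite openE => x [cx Ucx]; apply: filterI.
  by apply: open_nbhs_nbhs; split=> //; exact: atlas_cdom_open.
by apply: (cmap_continuous ac cx); exact: open_nbhs_nbhs.
Qed.

Definition overlap c c' : set E := cdom c `&` c @^-1` cimg c'.
Definition transition c c' : E -> E := cinv c' \o c.

Lemma overlap_open c c' : atlas c -> atlas c' -> open (overlap c c').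
Proof. by move=> ac ac'; apply: open_cpreimage => //; exact: atlas_cimg_open. Qed.

Lemma transitionE c c' x : atlas c' -> overlap c c' x ->
  c' (transition c c' x) = c x.
Proof. by move=> ac' [_ /(cinvK ac')[]]. Qed.

Lemma transition_overlap c c' x : atlas c' -> overlap c c' x ->
  overlap c' c (transition c c' x).
Proof.
move=> ac' cx; split; first by case: cx => _ /(cinvK ac')[].
by rewrite /preimage /= transitionE //; exact/cimg_cmap/cx.1.
Qed.

Lemma transitionK c c' x : atlas c -> atlas c' -> overlap c c' x ->
  transition c' c (transition c c' x) = x.
Proof.
move=> ac ac' cx; rewrite {1}/transition /= transitionE //.
by rewrite cmapK //; exact: cx.1.
Qed.

Lemma transition_smooth k c c' i : atlas c -> atlas c' ->
  Ck k (overlap c c') (fun x => transition c c' x 0 i).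
Proof. by move=> ac ac'; exact: (atlas_smooth ac ac'). Qed.

Lemma transition_differentiable c c' x : atlas c -> atlas c' ->
  overlap c c' x -> differentiable (transition c c') x.
Proof.
move=> ac ac'; apply: Ck_row_differentiable => i.
exact: transition_smooth 1 _ _ _ ac ac'.
Qed.

Lemma diff_transition_comp c c' c'' x v : atlas c -> atlas c' -> atlas c'' ->
  overlap c c' x -> overlap c c'' x ->
  'd (transition c' c'') (transition c c' x) ('d (transition c c') x v) =
  'd (transition c c'') x v.
Proof.
move=> ac ac' ac'' x1 x2.
have d1 := transition_differentiable ac ac' x1.
have x3 : overlap c' c'' (transition c c' x).
  split; first by have [] := transition_overlap ac' x1.
  by rewrite /preimage /= transitionE //; exact: x2.2.
have d2 := transition_differentiable ac' ac'' x3.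
have d3 := transition_differentiable ac ac'' x2.
have near3 : {near x, transition c c'' =1 transition c' c'' \o transition c c'}.
  apply: nbhs_in_open (overlap_open ac ac') x1 _ => y y1.
  by rewrite /= [in RHS]/transition /= transitionE.
transitivity ('d (transition c' c'' \o transition c c') x v).
  exact: (congr1 (fun h : E -> E => h v) (esym (diff_comp d1 d2))).
exact: (congr1 (fun h : E -> E => h v) (near_eq_differentiable near3 d3).2).
Qed.

Lemma diff_transition_id c x v : atlas c -> cdom c x ->
  'd (transition c c) x v = v.
Proof.
move=> ac cx.
have nid : {near x, @idfun E =1 transition c c}.
  apply: nbhs_in_open (atlas_cdom_open ac) cx _ => y cy.
  by rewrite /transition /= cmapK.
have did : differentiable (@idfun E) x by [].
have [_ ->] := near_eq_differentiable nid did.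
by rewrite diff_val.
Qed.

Section At.
Variables (p : M).
Implicit Types (xi eta : tangent p).

Lemma chart_at_overlap c c' : chart_at p c -> chart_at p c' ->
  overlap c c' (cinv c p).
Proof.
move=> [ac pc] [ac' pc']; have [? e] := cinvK ac pc; split=> //.
by rewrite /preimage /= e.
Qed.

Lemma tcoord_change xi c c' : chart_at p c -> chart_at p c' ->
  tcoord xi c' = 'd (transition c c') (cinv c p) (tcoord xi c).
Proof. by have /asboolP[_ H] := tcoordP xi; exact: H. Qed.

Lemma tcoord_inj xi eta c : chart_at p c -> tcoord xi c = tcoord eta c ->
  xi = eta.
Proof.
move=> pc e; apply: val_inj; apply/funext => c' /=.
have [pc'|npc'] := pselect (chart_at p c').
  by rewrite (tcoord_change _ pc pc') e -tcoord_change.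
have /asboolP[H _] := tcoordP xi; have /asboolP[H' _] := tcoordP eta.
by rewrite H // H'.
Qed.

(** The vector with coordinates [a] in [c] has the coordinates prescribed by the
    transformation law in the other charts; the chain rule for transitions
    makes this assignment consistent. *)
Lemma tcoord_dchart c a : chart_at p c -> tcoord (dchart c p a) c = a.
Proof.
move=> pc.
pose xi0 c' :=
  if pselect (chart_at p c') then 'd (transition c c') (cinv c p) a else 0.
have xi0P : xi0 \in @tangent_law R d M p.
  apply/asboolP; split=> [c' npc'|c' c'' pc' pc'']; rewrite /xi0.
    by case: pselect.
  case: (pselect (chart_at p c'')) => // p2.
  case: (pselect (chart_at p c')) => // p1.
  have -> : cinv c' p = transition c c' (cinv c p).
    by rewrite /transition /=; have [_ ->] := cinvK pc.1 pc.2.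
  exact: (esym (diff_transition_comp a pc.1 p1.1 p2.1
    (chart_at_overlap pc p1) (chart_at_overlap pc p2))).
have H : [set xi : tangent p | tcoord xi c = a] (Tangent xi0P).
  rewrite /= /xi0; case: (pselect (chart_at p c)) => // p1.
  by rewrite diff_transition_id //; [exact: pc.1|have [] := cinvK pc.1 pc.2].
exact: (xgetPex 0 (ex_intro _ _ H)).
Qed.

Lemma tcoordZ c a xi : tcoord (a *: xi) c = a *: tcoord xi c.
Proof. by []. Qed.

Lemma tcoordD c xi eta : tcoord (xi + eta) c = tcoord xi c + tcoord eta c.
Proof. by []. Qed.

Lemma tcoord0 c : tcoord (0 : tangent p) c = 0.
Proof. by []. Qed.

Lemma tcoordN c xi : tcoord (- xi) c = - tcoord xi c.
Proof. by []. Qed.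

End At.

Lemma some_chart_at (p : M) : chart_at p (some_chart p).
Proof. by rewrite /some_chart; case: cid. Qed.

Lemma chart_at_cmap c x : atlas c -> cdom c x -> chart_at (c x) c.
Proof. by move=> ac cx; split=> //; exact: cimg_cmap. Qed.

Lemma tcoord_field (X : forall p : M, tangent p) c c' x : atlas c -> atlas c' ->
  overlap c c' x ->
  tcoord (X (c' (transition c c' x))) c' =
  tcoord (X (c x)) c *m jacobian (transition c c') x.
Proof.
move=> ac ac' ox; rewrite transitionE //.
have [cx c'cx] := ox.
by rewrite (@tcoord_change _ _ c c') ?cmapK ?diff_jacobian //; exact: chart_at_cmap.
Qed.

End Charts.

(** * Positive matrices *)

Section Dot.
Context {R : realType} {d : nat}.
Local Notation E := 'rV[R]_d.
Implicit Types (a b : E) (A : 'M[R]_d).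

Lemma dotE a b : dot a b = (a *m b^T) 0 0.
Proof. by rewrite mxE; apply: eq_bigr => i _; rewrite mxE. Qed.

Lemma dotC a b : dot a b = dot b a.
Proof. by apply: eq_bigr => i _; rewrite mulrC. Qed.

Lemma dotDl a a' b : dot (a + a') b = dot a b + dot a' b.
Proof. by rewrite !dotE mulmxDl mxE. Qed.

Lemma dotZl k a b : dot (k *: a) b = k * dot a b.
Proof. by rewrite !dotE -scalemxAl mxE. Qed.

Lemma dotNl a b : dot (- a) b = - dot a b.
Proof. by rewrite -scaleN1r dotZl mulN1r. Qed.

Lemma dot_delta a i : dot a (delta_mx 0 i) = a 0 i.
Proof.
rewrite /dot (bigD1 i) //= big1 ?addr0 => [|j ji]; first by rewrite mxE !eqxx mulr1.
by rewrite mxE eqxx (negbTE ji) mulr0.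
Qed.

Lemma dot_inj a a' : (forall b, dot a b = dot a' b) -> a = a'.
Proof. by move=> aa'; apply/rowP => i; rewrite -!dot_delta. Qed.

Lemma dot_mul a b A : dot (a *m A) b = dot a (b *m A^T).
Proof. by rewrite !dotE trmx_mul trmxK mulmxA. Qed.

Lemma dot_mx_delta A i j : dot ((delta_mx 0 i : E) *m A) (delta_mx 0 j) = A i j.
Proof. by rewrite dot_delta -rowE mxE. Qed.

Lemma mx_dot_inj A A' : (forall a b, dot (a *m A) b = dot (a *m A') b) -> A = A'.
Proof. by move=> AA'; apply/matrixP => i j; rewrite -!dot_mx_delta. Qed.

Definition positive_mx A := forall a : E, a != 0 -> 0 < dot (a *m A) a.

Lemma positive_mx_unit A : positive_mx A -> A \in unitmx.
Proof.
move=> Apos; rewrite -row_free_unit -kermx_eq0; apply/rowV0P => a.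
move=> /sub_kermxP aA0; apply: contrapT => /eqP/Apos.
by rewrite aA0 dotE mul0mx mxE ltxx.
Qed.

(** The segment from the identity to a positive matrix consists of positive,
    hence invertible, matrices, so that the determinant keeps its sign on it. *)
Lemma positive_mx_det A : positive_mx A -> 0 < \det A.
Proof.
move=> Apos.
(* the determinant of [(1 - t) 1 + t A] as a polynomial in [t] *)
pose p := \det (\matrix_(i, j) (((i == j)%:R)%:P + 'X * (A i j - (i == j)%:R)%:P)).
have pE t : p.[t] = \det (1%:M + t *: (A - 1%:M)).
  rewrite -horner_evalE -det_map_mx; congr (\det _); apply/matrixP => i j.
  by rewrite !mxE /= horner_evalE !hornerE.
have dotself (a : E) : a != 0 -> 0 < dot a a.
  move=> a0; rewrite lt_neqAle sumr_ge0 ?andbT; last first.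
    by move=> i _; rewrite -expr2 sqr_ge0.
  apply: contraNneq a0 => /esym/eqP; rewrite psumr_eq0; last first.
    by move=> i _; rewrite -expr2 sqr_ge0.
  move=> /allP h; apply/eqP/rowP => i; rewrite mxE.
  by have := h i; rewrite mem_index_enum mulf_eq0 orbb => /(_ isT)/eqP.
rewrite ltNge; apply/negP => det0.
have [|t /andP[t0 t1] pt] := @poly_ivt R (- p) 0 1 ler01; rewrite ?hornerN.
  rewrite !pE scale0r addr0 det1 scale1r addrCA subrr addr0.
  by rewrite oppr_le0 ler01/= oppr_ge0.
move: pt; rewrite rootN => /rootP; rewrite pE => /eqP.
apply/negP; rewrite -unitfE; apply: positive_mx_unit => a a0.
rewrite mulmxDr mulmx1 -scalemxAr mulmxBr mulmx1.
have -> : dot (a + t *: (a *m A - a)) a = (1 - t) * dot a a + t * dot (a *m A) a.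
  by rewrite dotDl dotZl dotDl dotNl; ring.
have [->|tn0] := eqVneq t 0; first by rewrite subr0 mul1r mul0r addr0 dotself.
rewrite ltr_wpDl ?mulr_gt0 ?Apos// ?lt_neqAle ?[0 == t]eq_sym ?tn0//.
by rewrite mulr_ge0 ?subr_ge0// ltW// dotself.
Qed.

End Dot.

(** * Metric, gradient and divergence in a chart *)

Section Riemannian.
Context {R : realType} {d : nat} (M : riemannian R d).
Local Notation E := 'rV[R]_d.
Implicit Types (c : chart R d M).

Section Inner.
Variable p : M.
Implicit Types xi eta zeta : tangent p.

Lemma innerDl xi eta zeta : inner (xi + eta) zeta = inner xi zeta + inner eta zeta.
Proof. by rewrite -{1}[xi]scale1r inner_linear mul1r. Qed.

Lemma inner0l zeta : inner (0 : tangent p) zeta = 0.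
Proof. by apply: (addrI (inner 0 zeta)); rewrite -innerDl !addr0. Qed.

Lemma innerZl a xi zeta : inner (a *: xi) zeta = a * inner xi zeta.
Proof. by rewrite -[a *: xi]addr0 inner_linear inner0l addr0. Qed.

Lemma inner_suml (I : Type) (r : seq I) (f : I -> tangent p) zeta :
  inner (\sum_(i <- r) f i) zeta = \sum_(i <- r) inner (f i) zeta.
Proof.
elim: r => [|i r IH]; first by rewrite !big_nil inner0l.
by rewrite !big_cons innerDl IH.
Qed.

End Inner.

Section Chart.
Variable c : chart R d M.
Hypothesis ac : atlas c.

Lemma tangent_sum x (xi : tangent (c x)) : cdom c x ->
  xi = \sum_i tcoord xi c 0 i *: dchart c (c x) (delta_mx 0 i).
Proof.
move=> cx; have pc := chart_at_cmap ac cx; apply: (tcoord_inj pc).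
have tsum (r : seq 'I_d) :
    tcoord (\sum_(i <- r) tcoord xi c 0 i *: dchart c (c x) (delta_mx 0 i)) c =
    \sum_(i <- r) tcoord xi c 0 i *: delta_mx 0 i.
  elim: r => [|i r IH]; first by rewrite !big_nil tcoord0.
  by rewrite !big_cons tcoordD IH tcoordZ tcoord_dchart.
by rewrite tsum -row_sum_delta.
Qed.

Lemma inner_gram x (xi eta : tangent (c x)) : cdom c x ->
  inner xi eta = dot (tcoord xi c *m gram c x) (tcoord eta c).
Proof.
move=> cx; rewrite {1}(tangent_sum xi cx) inner_suml dotE.
rewrite -mulmxA mxE; apply: eq_bigr => i _; rewrite innerZl inner_sym.
congr (_ * _); rewrite {1}(tangent_sum eta cx) inner_suml mxE.
by apply: eq_bigr => j _; rewrite innerZl inner_sym !mxE mulrC.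
Qed.

Lemma inner_gram_at p (xi eta : tangent p) : chart_at p c ->
  inner xi eta = dot (tcoord xi c *m gram c (cinv c p)) (tcoord eta c).
Proof.
move=> [_ [x cx xp]]; move: xi eta; rewrite -xp => xi eta.
by rewrite cmapK // inner_gram.
Qed.

Lemma gramT x : (gram c x)^T = gram c x.
Proof. by apply/matrixP => i j; rewrite !mxE inner_sym. Qed.

Lemma gram_positive x : cdom c x -> positive_mx (gram c x).
Proof.
move=> cx a a0; have pc := chart_at_cmap ac cx.
rewrite -[X in X *m _](tcoord_dchart a pc) -[X in dot _ X](tcoord_dchart a pc).
rewrite -inner_gram //; apply: inner_gt0; apply: contraNneq a0 => a0.
by rewrite -(tcoord_dchart a pc) a0 tcoord0.
Qed.

Lemma gram_det_gt0 x : cdom c x -> 0 < \det (gram c x).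
Proof. by move=> cx; exact/positive_mx_det/gram_positive. Qed.

Lemma gram_unit x : cdom c x -> gram c x \in unitmx.
Proof. by move=> cx; exact/positive_mx_unit/gram_positive. Qed.

Lemma gram_smooth k i j : Ck k (cdom c) (fun x => gram c x i j).
Proof.
apply: (Ck_ext (atlas_cdom_open ac) _ (inner_smooth ac i j k)) => x _.
by rewrite mxE.
Qed.

Definition volume_density x := Num.sqrt (\det (gram c x)).

Lemma volume_density_gt0 x : cdom c x -> 0 < volume_density x.
Proof. by move=> cx; rewrite sqrtr_gt0 gram_det_gt0. Qed.

Lemma volume_density_smooth k : Ck k (cdom c) volume_density.
Proof.
have oc := atlas_cdom_open ac.
apply: Ck_sqrt => //; first exact: gram_det_gt0.
by apply: Ck_det => // i j; exact: gram_smooth.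
Qed.

Lemma adjointE x (eta : tangent (c x)) : cdom c x ->
  adjoint (dchart c (c x)) eta = tcoord eta c *m gram c x.
Proof.
move=> cx; have pc := chart_at_cmap ac cx.
have H : [set a : E | forall b, dot a b = inner eta (dchart c (c x) b)]
    (tcoord eta c *m gram c x).
  by move=> b; rewrite inner_gram // tcoord_dchart.
have H' := xgetPex 0 (ex_intro _ _ H).
by apply: dot_inj => b; rewrite (H' b) (H b).
Qed.

End Chart.

Lemma gram_transition c c' x : atlas c -> atlas c' -> overlap c c' x ->
  gram c x = jacobian (transition c c') x *m gram c' (transition c c' x) *m
             (jacobian (transition c c') x)^T.
Proof.
move=> ac ac' ox; have [cx c'cx] := ox.
have [c'x _] := transition_overlap ac' ox.
have pc := chart_at_cmap ac cx.
have eqp := transitionE ac' ox.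
have pc' : chart_at (c x) c' by split.
have inner' (xi eta : tangent (c x)) : inner xi eta =
    dot (tcoord xi c' *m gram c' (transition c c' x)) (tcoord eta c').
  by move: xi eta; rewrite -eqp => xi eta; exact: inner_gram.
apply: mx_dot_inj => a b.
have changed v : tcoord (dchart c (c x) v) c' = v *m jacobian (transition c c') x.
  rewrite (tcoord_change _ pc pc').
  by rewrite cmapK // tcoord_dchart // diff_jacobian.
transitivity (inner (dchart c (c x) a) (dchart c (c x) b)).
  by rewrite (inner_gram ac) // !tcoord_dchart.
by rewrite inner' !changed !mulmxA [RHS]dot_mul trmxK.
Qed.

(** A change of chart acts on the Gram matrix by congruence, hence multiplies its
    determinant by the square of the Jacobian determinant. *)
Lemma volume_density_transition c c' x : atlas c -> atlas c' -> overlap c c' x ->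
  volume_density c x =
  `|\det (jacobian (transition c c') x)| * volume_density c' (transition c c' x).
Proof.
move=> ac ac' ox; rewrite /volume_density (gram_transition ac ac' ox).
rewrite !det_mulmx det_tr mulrAC -expr2 sqrtrM ?sqr_ge0 // sqrtr_sqr.
by [].
Qed.

(** The differential is computed in a chosen chart; the chain rule moves it to
    any chart around the point. *)
Lemma dfunE c (f : M -> R) x (xi : tangent (c x)) : atlas c -> cdom c x ->
  differentiable (f \o c) x -> dfun f xi = 'd (f \o c) x (tcoord xi c).
Proof.
move=> ac cx df; rewrite /dfun; set c' := some_chart (c x).
have pc : chart_at (c x) c by exact: chart_at_cmap.
have pc' : chart_at (c x) c' by exact: some_chart_at.
have ac' := pc'.1.
have ox : overlap c c' x by rewrite -[x](cmapK ac cx); exact: chart_at_overlap.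
have o'x := transition_overlap ac' ox.
have dT' := transition_differentiable ac' ac o'x.
have e : transition c' c (transition c c' x) = x by rewrite transitionK.
have n' : {near transition c c' x, (f \o c) \o transition c' c =1 f \o c'}.
  apply: nbhs_in_open (overlap_open ac' ac) o'x _ => y oy.
  by rewrite /= transitionE.
have df' : differentiable (f \o c) (transition c' c (transition c c' x)).
  by rewrite e.
have dcomp := differentiable_comp dT' df'.
have d' := (near_eq_differentiable n' dcomp).2.
transitivity ('d ((f \o c) \o transition c' c) (transition c c' x) (tcoord xi c')).
  exact: (congr1 (fun h : E -> R => h (tcoord xi c')) d').
transitivity ('d (f \o c) (transition c' c (transition c c' x))
  ('d (transition c' c) (transition c c' x) (tcoord xi c'))).
  exact: (congr1 (fun h : E -> R => h (tcoord xi c')) (diff_comp dT' df')).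
rewrite e; congr ('d _ _ _).
by rewrite [RHS](tcoord_change _ pc' pc).
Qed.

(** The Riesz representation of the differential, obtained by inverting the Gram
    matrix. *)
Lemma gradM_inner (f : M -> R) (p : M) (xi : tangent p) :
  inner (gradM f p) xi = dfun f xi.
Proof.
set c := some_chart p; have pc : chart_at p c by exact: some_chart_at.
have ac := pc.1.
suff [G GP] : exists G : tangent p, forall xi, inner G xi = dfun f xi.
  have H : exists G, [set G : tangent p | forall xi, inner G xi = dfun f xi] G.
    by exists G.
  exact: (xgetPex 0 H).
have [cx cxp] := cinvK ac pc.2.
pose r : E := \row_i 'd (f \o c) (cinv c p) (delta_mx 0 i).
exists (dchart c p (r *m invmx (gram c (cinv c p)))) => eta.
rewrite (inner_gram_at ac _ _ pc) tcoord_dchart // mulmxKV ?gram_unit //.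
rewrite /dfun -/c {2}(row_sum_delta (tcoord eta c)) linear_sum.
by apply: eq_bigr => i _; rewrite linearZ mxE mulrC.
Qed.

(** Let [T] be the transition to the chart in which the divergence is computed,
    and [J] its Jacobian matrix. The field multiplied by the density of the
    second chart is the image under [J] of [V], the field in the chart [c]
    multiplied by the same density, and [volume_density c] is [|det J|] times
    that density; so the Piola identity applies, up to the sign of [det J],
    which is locally constant. *)
Lemma divergME c (X : forall p : M, tangent p) x : atlas c -> cdom c x ->
  differentiable (fun y => tcoord (X (c y)) c) x ->
  divergM X (c x) = (volume_density c x)^-1 *
    diverg (fun y => volume_density c y *: tcoord (X (c y)) c) x.
Proof.
move=> ac cx dX; rewrite /divergM; set c' := some_chart (c x).
have pc : chart_at (c x) c by exact: chart_at_cmap.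
have pc' : chart_at (c x) c' by exact: some_chart_at.
have ac' := pc'.1.
have ox : overlap c c' x by rewrite -[x](cmapK ac cx); exact: chart_at_overlap.
have o'x := transition_overlap ac' ox.
have oo := overlap_open ac ac'.
set T := transition c c'; set T' := transition c' c.
set J := jacobian T.
rewrite -/(T x) -/(volume_density c' _).
pose V y := volume_density c' (T y) *: tcoord (X (c y)) c.
pose Z y := volume_density c' y *: tcoord (X (c' y)) c'.
have cT i k : Ck k (overlap c c') (fun y => T y 0 i) by exact: transition_smooth.
have dT : differentiable T x by exact: transition_differentiable.
have dT' : differentiable T' (T x) by exact: transition_differentiable.
have T'T : T' (T x) = x by exact: transitionK.
have dV : differentiable V x.
  apply: differentiable_row => i.
  rewrite (_ : (fun y => _) =
      (volume_density c' \o T) * (fun y => tcoord (X (c y)) c 0 i)); last first.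
    by apply/funext => y; rewrite mxE.
  apply: differentiableM; last exact: differentiable_coordinate dX.
  apply: differentiable_comp dT _.
  exact: (volume_density_smooth ac' 1).1 _ o'x.1.
have cJ i j : Ck 1 (overlap c c') (fun y => J y i j) by apply: Ck_jacobian.
have ZV y : overlap c c' y -> Z (T y) = V y *m J y.
  by move=> oy; rewrite /Z tcoord_field // scalemxAl.
have dVJ : differentiable (fun y => V y *m J y) x.
  apply: differentiable_row => j.
  rewrite (_ : (fun y => _) =
      \sum_i ((fun y => V y 0 i) * (fun y => J y i j))); last first.
    by apply/funext => y; rewrite mxE fct_sumE.
  apply: differentiable_sum => i; apply: differentiableM.
    exact: differentiable_coordinate dV.
  exact: (cJ i j).1 x ox.
have dZ : differentiable Z (T x).
  have nZ : {near T x, (fun y => V y *m J y) \o T' =1 Z}.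
    apply: nbhs_in_open (overlap_open ac' ac) o'x _ => y oy /=.
    by rewrite -ZV; [rewrite /T /T' transitionK|exact: transition_overlap].
  apply: (near_eq_differentiable nZ _).1; apply: differentiable_comp dT' _.
  by rewrite T'T.
have nZV : {near x, (fun y => Z (T y)) =1 (fun y => V y *m J y)}.
  by apply: nbhs_in_open oo ox _ => y; exact: ZV.
have P := piola oo ox (fun i => cT i 2) dV dZ nZV.
set e := Num.sg (\det (J x)).
have dets : volume_density c x = `|\det (J x)| * volume_density c' (T x).
  exact: volume_density_transition.
have det0 : \det (J x) != 0.
  apply: contraTneq (volume_density_gt0 ac cx) => J0.
  by rewrite dets J0 normr0 mul0r ltxx.
have cdet : Ck 1 (overlap c c') (fun y => \det (J y)) by apply: Ck_det.
have ndet : \forall y \near x, `|\det (J y)| = e * \det (J y).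
  have cd : {for x, continuous (fun y => \det (J y))}.
    exact: Ck_continuous cdet _ ox.
  rewrite /e; move: det0; rewrite neq_lt => /orP[J0|J0].
    apply: filterS (cvgr_lt _ cd _ J0) => y Jy.
    by rewrite (ltr0_sg J0) mulN1r (ltr0_norm Jy).
  apply: filterS (cvgr_gt _ cd _ J0) => y Jy.
  by rewrite (gtr0_sg J0) mul1r (gtr0_norm Jy).
have nsV : {near x, (fun y => volume_density c y *: tcoord (X (c y)) c) =1
                    (fun y => e *: (\det (J y) *: V y))}.
  near=> y; rewrite /V !scalerA; congr (_ *: _).
  have -> : e * \det (J y) = `|\det (J y)| by near: y; apply: filterS ndet => y ->.
  apply: volume_density_transition => //.
  by near: y; exact: nbhs_in_open oo ox _.
rewrite (near_eq_diverg nsV).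
have ddet : differentiable (fun y => \det (J y)) x by exact: cdet.1 x ox.
have dF : differentiable (fun y => \det (J y) *: V y) x.
  apply: differentiable_row => i.
  rewrite (_ : (fun y => _) =
      (fun y => \det (J y)) * (fun y => V y 0 i)); last first.
    by apply/funext => y; rewrite mxE.
  by apply: differentiableM => //; exact: differentiable_coordinate dV.
have de : differentiable (fun=> e : R) x by exact: differentiable_cst.
rewrite (diverg_scale de dF).
rewrite derive_cst addr0 P dets -/(Z).
have s0 : volume_density c' (T x) != 0.
  exact/lt0r_neq0/volume_density_gt0/o'x.1.
rewrite normrEsg -/e; field.
by rewrite s0 det0 /e sgr_eq0 det0.
Unshelve. all: by end_near. Qed.

End Riemannian.

(** * Reading functions and fields in one chart *)

Section Transfer.
Context {R : realType} {d : nat} (M : riemannian R d) (rho : chart R d M).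
Hypothesis arho : atlas rho.
Local Notation E := 'rV[R]_d.
Local Notation O := (cdom rho).
Local Notation U := (cimg rho).
Local Notation s := (volume_density rho).
Implicit Types (f phi : M -> R) (X : forall p : M, tangent p).

Definition chart_field X (x : E) : E := tcoord (X (rho x)) rho.

Lemma domain_open : open O. Proof. exact: atlas_cdom_open. Qed.
Lemma image_open : open U. Proof. exact: atlas_cimg_open. Qed.

Lemma domain_measurable : measurable (O : set (borel E)).
Proof. apply: open_borel; exact: domain_open. Qed.
Lemma image_measurable : measurable (U : set (borel M)).
Proof. apply: open_borel; exact: image_open. Qed.

Lemma CkM_chart k f : CkM k U f -> Ck k O (f \o rho).
Proof. by move=> /(_ rho arho); apply: Ck_sub => x Ox; split=> //; exact: cimg_cmap. Qed.

Lemma CkTM_chart k X i : CkTM k U X -> Ck k O (fun x => chart_field X x 0 i).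
Proof.
by move=> /(_ rho arho i); apply: Ck_sub => x Ox; split=> //; exact: cimg_cmap.
Qed.

Lemma chart_CkM k f : Ck k O (f \o rho) -> CkM k U f.
Proof.
move=> cf c ac; have oo := overlap_open ac arho.
have H : Ck k (overlap c rho) (fun x => (f \o rho) (transition c rho x)).
  apply: (Ck_comp oo _ _ cf) => [x ox|i]; last exact: transition_smooth.
  exact: (transition_overlap arho ox).1.
by apply: (Ck_ext oo _ H) => x ox /=; rewrite transitionE.
Qed.

(** The Jacobian matrix and the transition in this formula are smooth, so that
    smoothness and measurability in all charts follow from those in [rho]. *)
Lemma chart_field_transition c X x : atlas c -> overlap c rho x ->
  tcoord (X (c x)) c = chart_field X (transition c rho x) *m
                       jacobian (transition rho c) (transition c rho x).
Proof.
move=> ac ox; have o'x := transition_overlap arho ox.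
by rewrite -(tcoord_field X arho ac o'x) (transitionK ac arho ox).
Qed.

Lemma chart_CkTM k X : (forall i, Ck k O (fun x => chart_field X x 0 i)) ->
  CkTM k U X.
Proof.
move=> cX c ac i; have oo := overlap_open ac arho.
have oo' := overlap_open arho ac.
have cT j := @transition_smooth _ _ _ k c rho j ac arho.
have H : Ck k (overlap c rho) (fun x => \sum_j chart_field X (transition c rho x) 0 j *
    jacobian (transition rho c) (transition c rho x) j i).
  have sub x : overlap c rho x -> overlap rho c (transition c rho x).
    exact: transition_overlap.
  apply: (@Ck_comp _ _ k _ _ (fun y => \sum_j chart_field X y 0 j *
    jacobian (transition rho c) y j i) _ oo sub cT).
  apply: Ck_sum => // j _; apply: Ck_mul => //; first by apply: Ck_sub (cX j) => y [].
  by apply: Ck_jacobian => // l; exact: transition_smooth.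
apply: (Ck_ext oo _ H) => x ox.
by rewrite (chart_field_transition X ac ox) [RHS]mxE.
Qed.

Lemma chart_measurable f :
  measurable_fun (O : set (borel E)) (f \o rho : borel E -> R) ->
  measurable_fun (U : set (borel M)) (f : borel M -> R).
Proof.
move=> mf; apply: (@eq_measurable_fun _ _ (borel M) _ _ ((f \o rho) \o cinv rho)).
  by move=> p /[!inE] Up /=; have [_ ->] := cinvK arho Up.
have mcinv : measurable_fun (U : set (borel M)) (cinv rho : borel M -> borel E).
  by apply: continuous_borel; [exact: image_open|move=> p; exact: cinv_continuous].
apply: (measurable_comp domain_measurable _ mf mcinv) => _ [p Up <-].
by have [] := cinvK arho Up.
Qed.

Lemma rho_measurable : measurable_fun (O : set (borel E)) (rho : borel E -> borel M).
Proof.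
by apply: continuous_borel; [exact: domain_open|move=> x; exact: cmap_continuous].
Qed.

Lemma measurable_chart f : measurable_fun (U : set (borel M)) (f : borel M -> R) ->
  measurable_fun (O : set (borel E)) (f \o rho : borel E -> R).
Proof.
move=> mf; apply: (measurable_comp image_measurable _ mf rho_measurable) => _ [x Ox <-].
exact: cimg_cmap.
Qed.

Lemma Ck_measurable k (O' : set E) (h : E -> R) : open O' -> Ck k O' h ->
  measurable_fun (O' : set (borel E)) (h : borel E -> R).
Proof.
move=> oO' ch; apply: continuous_measurable => // x.
exact: Ck_continuous ch _.
Qed.

Definition measurable_fieldM X := forall c, atlas c -> forall i,
  measurable_fun (overlap c rho : set (borel E))
    ((fun x => tcoord (X (c x)) c 0 i) : borel E -> R).

Definition measurable_field (D : set E) (F : E -> E) := forall i,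
  measurable_fun (D : set (borel E)) ((fun x => F x 0 i) : borel E -> R).

Lemma measurable_fieldM_chart X : measurable_fieldM X ->
  measurable_field O (chart_field X).
Proof.
move=> /(_ rho arho) mX i; have -> // : O = overlap rho rho.
by apply/seteqP; split=> x => [Ox|[]//]; split=> //; exact: cimg_cmap.
Qed.

Lemma chart_measurable_fieldM X : measurable_field O (chart_field X) ->
  measurable_fieldM X.
Proof.
move=> mX c ac i; have oo := overlap_open ac arho.
have oo' := overlap_open arho ac.
pose h y := \sum_j chart_field X y 0 j * jacobian (transition rho c) y j i.
have mh : measurable_fun (overlap rho c : set (borel E)) (h : borel E -> R).
  apply: measurable_sum => j; apply: measurable_funM.
    apply: (@measurable_funS _ _ (borel E) _ O) (mX j) => [|y []//].
    exact: domain_measurable.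
  apply: (@Ck_measurable 0) => //; apply: Ck_jacobian => // l.
  exact: transition_smooth.
have mT : measurable_fun (overlap c rho : set (borel E))
    (transition c rho : borel E -> borel E).
  apply: continuous_borel; [exact: oo|move=> x ox].
  apply: (@Ck_row_continuous _ _ 0) ox => l.
  exact: transition_smooth.
apply: (@eq_measurable_fun _ _ (borel E) _ _ (h \o transition c rho)).
  move=> x /[!inE] ox.
  by rewrite /h /= [in RHS](chart_field_transition X ac ox) [RHS]mxE.
apply: (measurable_comp (open_borel oo') _ mh mT) => _ [x ox <-].
exact: transition_overlap.
Qed.

Lemma measurable_fieldMx (D : set E) (F : E -> E) (A : E -> 'M[R]_d) :
  measurable_field D F ->
  (forall i j, measurable_fun (D : set (borel E)) ((fun x => A x i j) : borel E -> R)) ->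
  measurable_field D (fun x => F x *m A x).
Proof.
move=> mF mA i.
have H : measurable_fun (D : set (borel E))
    ((fun x => \sum_j F x 0 j * A x j i) : borel E -> R).
  by apply: measurable_sum => j; apply: measurable_funM.
by apply: (eq_measurable_fun _ _ H) => x _; rewrite mxE.
Qed.

Lemma measurable_dot (D : set E) (F G : E -> E) :
  measurable_field D F -> measurable_field D G ->
  measurable_fun (D : set (borel E)) ((fun x => dot (F x) (G x)) : borel E -> R).
Proof. by move=> mF mG; apply: measurable_sum => j; apply: measurable_funM. Qed.

Lemma gram_measurable i j :
  measurable_fun (O : set (borel E)) ((fun x => gram rho x i j) : borel E -> R).
Proof. by apply: (@Ck_measurable 0); [exact: domain_open|exact: gram_smooth]. Qed.

Lemma density_measurable : measurable_fun (O : set (borel E)) (s : borel E -> R).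
Proof. by apply: (@Ck_measurable 0); [exact: domain_open|exact: volume_density_smooth]. Qed.

Lemma compact_chart (K : set M) : compact K -> K `<=` U ->
  compact (cinv rho @` K) /\ cinv rho @` K `<=` O.
Proof.
move=> cK KU; split; last by move=> _ [p /KU Up <-]; have [] := cinvK arho Up.
apply: continuous_compact => //; apply: continuous_in_subspaceT => p /[!inE] /KU.
exact: cinv_continuous.
Qed.

Lemma compact_cmap (K : set E) : compact K -> K `<=` O ->
  compact (rho @` K) /\ rho @` K `<=` U.
Proof.
move=> cK KO; split; last by move=> _ [x /KO Ox <-]; exact: cimg_cmap.
apply: continuous_compact => //; apply: continuous_in_subspaceT => x /[!inE] /KO.
exact: cmap_continuous.
Qed.

Lemma test_funM_chart phi : test_funM U phi ->
  exists2 h, test_fun O h & forall x, O x -> h x = phi (rho x).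
Proof.
move=> [sphi [K cK [KU K0]]]; have [cK' K'O] := compact_chart cK KU.
pose h x := if pselect (O x) then phi (rho x) else 0.
have hE x : O x -> h x = phi (rho x) by move=> Ox; rewrite /h; case: pselect.
exists h => //; split=> [k|].
  by apply: (Ck_ext domain_open _ (CkM_chart (sphi k))) => x Ox; rewrite hE.
exists (cinv rho @` K) => //; split=> // x nKx; rewrite /h; case: pselect => // Ox.
apply: K0 => Krx; apply: nKx; exists (rho x) => //; exact: cmapK.
Qed.

Lemma chart_test_funM h : test_fun O h ->
  exists2 phi, test_funM U phi & forall x, O x -> h x = phi (rho x).
Proof.
move=> [sh [K cK [KO K0]]]; have [cK' K'U] := compact_cmap cK KO.
pose phi p := if pselect (U p) then h (cinv rho p) else 0.
have phiE x : O x -> h x = phi (rho x).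
  move=> Ox; rewrite /phi; case: (pselect (U (rho x))) => [Ux|]; first by rewrite cmapK.
  by case; exact: cimg_cmap.
exists phi => //; split=> [k|].
  by apply: chart_CkM; apply: (Ck_ext domain_open _ (sh k)) => x Ox; rewrite phiE.
exists (rho @` K) => //; split=> // p nKp; rewrite /phi.
case: (pselect (U p)) => // Up; apply: K0 => Kp; apply: nKp.
by exists (cinv rho p) => //; have [] := cinvK arho Up.
Qed.

Lemma test_fieldM_chart X : test_fieldM U X ->
  exists2 F, test_field O F & forall x, O x -> F x = s x *: chart_field X x.
Proof.
move=> [sX [K cK [KU K0]]]; have [cK' K'O] := compact_chart cK KU.
pose F x := if pselect (O x) then s x *: chart_field X x else 0.
have FE x : O x -> F x = s x *: chart_field X x by move=> Ox; rewrite /F; case: pselect.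
exists F => //; split=> [i k|].
  have cs := volume_density_smooth arho k.
  apply: (Ck_ext domain_open _ (Ck_mul domain_open cs (CkTM_chart i (sX k)))) => x Ox.
  by rewrite FE // mxE.
exists (cinv rho @` K) => //; split=> // x nKx; rewrite /F; case: pselect => // Ox.
rewrite /chart_field K0 ?tcoord0 ?scaler0 // => Krx; apply: nKx.
by exists (rho x) => //; exact: cmapK.
Qed.

Lemma chart_test_fieldM F : test_field O F ->
  exists2 X, test_fieldM U X & forall x, O x -> F x = s x *: chart_field X x.
Proof.
move=> [sF [K cK [KO K0]]]; have [cK' K'U] := compact_cmap cK KO.
pose X p : tangent p := if pselect (U p) then
  dchart rho p ((s (cinv rho p))^-1 *: F (cinv rho p)) else 0.
have XE x : O x -> chart_field X x = (s x)^-1 *: F x.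
  move=> Ox; rewrite /chart_field /X.
  case: (pselect (U (rho x))) => [Ux|]; last by case; exact: cimg_cmap.
  by rewrite tcoord_dchart ?cmapK //; exact: chart_at_cmap.
have s0 x : O x -> s x != 0 by move=> Ox; exact/lt0r_neq0/volume_density_gt0.
exists X => [|x Ox]; last by rewrite XE // scalerA divff ?scale1r ?s0.
split=> [k|].
  have cs := Ck_inv domain_open s0 (volume_density_smooth arho k).
  apply: chart_CkTM => i.
  apply: (Ck_ext domain_open _ (Ck_mul domain_open cs (sF i k))) => x Ox.
  by rewrite XE // mxE.
exists (rho @` K) => //; split=> // p nKp; rewrite /X.
case: (pselect (U p)) => // Up; have [_ e] := cinvK arho Up.
have -> : F (cinv rho p) = 0 by apply: K0 => Kp; apply: nKp; exists (cinv rho p).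
have pc : chart_at p rho by split.
by apply: (tcoord_inj pc); rewrite tcoord_dchart // scaler0.
Qed.

End Transfer.

(** * Complex vectors *)

Section ComplexVectors.
Local Open Scope complex_scope.
Context {R : realType} {d : nat}.
Local Notation E := 'rV[R]_d.

Lemma re_vecC (a b : E) : map_mx (@complex.Re R) (vecC a b) = a.
Proof. by apply/rowP => i; rewrite !mxE. Qed.

Lemma im_vecC (a b : E) : map_mx (@complex.Im R) (vecC a b) = b.
Proof. by apply/rowP => i; rewrite !mxE. Qed.

Lemma sum_complex (I : Type) (r : seq I) (f h : I -> R) :
  \sum_(i <- r) (f i +i* h i) = (\sum_(i <- r) f i) +i* (\sum_(i <- r) h i).
Proof. by elim/big_rec3: _ => // i x y z _ ->; rewrite /GRing.add. Qed.

Lemma vecC_lin (r m : R) (a b a' b' : E) :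
  vecC (r *: a - m *: b + a') (r *: b + m *: a + b') =
  (r +i* m) *: vecC a b + vecC a' b'.
Proof. by apply/rowP => i; rewrite !mxE. Qed.

Lemma vecC_mul (a b : E) (A : 'M[R]_d) :
  vecC a b *m map_mx (real_complex R) A = vecC (a *m A) (b *m A).
Proof.
apply/rowP => j; rewrite !mxE -sum_complex; apply: eq_bigr => i _.
by rewrite !mxE; apply/eqP; rewrite eq_complex /= !mulr0 subr0 add0r !eqxx.
Qed.

(** The cross terms between the real and the imaginary parts are imaginary. *)
Lemma hermC_vecC (A : 'M[R]_d) (a b : E) :
  Defs.hermC A (vecC a b) = dot (a *m A^T) a + dot (b *m A^T) b.
Proof.
rewrite /Defs.hermC map_trmx vecC_mul mxE /dot -big_split /=.
rewrite (eq_bigr (fun j => ((a *m A^T) 0 j * a 0 j + (b *m A^T) 0 j * b 0 j) +i*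
   ((b *m A^T) 0 j * a 0 j - (a *m A^T) 0 j * b 0 j))); last first.
  move=> j _; rewrite !mxE; apply/eqP; rewrite eq_complex /= mulrN opprK eqxx /=.
  by rewrite mulrN addrC.
by rewrite sum_complex.
Qed.

End ComplexVectors.

(** * The isometry and the intertwining *)

Section Weights.
Context {R : realType} {d : nat}.
Local Notation E := 'rV[R]_d.
Context {lam : {measure set (borel E) -> \bar R}}.
Hypothesis hlam : is_lebesgue_measure lam.
Context {mu : E -> R} {W : E -> 'M[R]_d}.
Hypothesis hmu : scalar_weight lam mu.
Context {M : riemannian R d} {vol : {measure set (borel M) -> \bar R}}.
Hypothesis hvol : riemannian_measure lam vol.
Context {rho : chart R d M}.
Hypothesis arho : atlas rho.
Local Notation O := (cdom rho).
Local Notation U := (cimg rho).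
Local Notation s := (volume_density rho).
Hypothesis smooth_mu : smooth_on O mu.
Context {g : E -> 'M[R]_d}.
Hypothesis hg : forall x, O x -> g x = mu x *: invmx (W x).
Context {nu : M -> R}.
Hypothesis hnu : forall x, O x -> nu (rho x) = mu x / Num.sqrt (\det (g x)).
Hypothesis hmetric : forall x, O x -> forall a : E,
  adjoint (dchart rho (rho x)) (dchart rho (rho x) a) = a *m (g x)^T.

(** In the chart, the adjoint of the differential is the multiplication by the
    Gram matrix. *)
Lemma metric_gram x : O x -> g x = gram rho x.
Proof.
move=> Ox; apply: (can_inj (@trmxK _ _ _)); rewrite gramT.
apply: mx_dot_inj => a b; rewrite -hmetric // adjointE //.
by rewrite tcoord_dchart //; exact: chart_at_cmap.
Qed.

(** The weight is positive almost everywhere, hence nonnegative on [O] by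
    continuity; it does not vanish because the metric is invertible. In
    dimension 0 the space is a point, which has positive measure. *)
Lemma weight_gt0 x : O x -> 0 < mu x.
Proof.
move=> Ox.
have mu0 : 0 <= mu x.
  rewrite leNgt; apply/negP => mux.
  have cmu : {for x, continuous mu} by exact: (smooth_mu 0).
  have nneg : \forall y \near x, mu y < 0 by exact: cvgr_lt cmu _ mux.
  have [||y /interior_subset /= yn yp] := lebesgue_ae_dense
      (A := interior [set y : E | mu y < 0]) hlam hmu.2.
  - exact: open_interior.
  - by exists x.
  - by have := lt_trans yn yp; rewrite ltxx.
rewrite lt_neqAle mu0 andbT; apply/eqP => mux.
have [d0|d0] := posnP d.
  (* the point where [mu] is positive can only be [x] *)
  have [||y _] := lebesgue_ae_dense (A := [set: E]) hlam hmu.2.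
  - exact: openT.
  - by exists x.
  - have -> : y = x by apply/rowP => i; have := ltn_ord i; rewrite {2}d0.
    by rewrite -mux ltxx.
have e0 : (delta_mx 0 (Ordinal d0) : E) != 0.
  apply/eqP => /rowP/(_ (Ordinal d0)); rewrite !mxE !eqxx => /eqP.
  by rewrite oner_eq0.
have := gram_positive arho Ox e0.
by rewrite -metric_gram // hg // -mux scale0r mulmx0 dotE mul0mx mxE ltxx.
Qed.

Lemma matrix_weight_gram x : O x -> W x = mu x *: invmx (gram rho x).
Proof.
move=> Ox; have mu0 := lt0r_neq0 (weight_gt0 Ox).
have e : invmx (W x) = (mu x)^-1 *: gram rho x.
  by rewrite -metric_gram // hg // scalerA mulVf // scale1r.
rewrite -[LHS]invmxK e invmxZ ?invrK //.
by rewrite unitmxZ ?gram_unit // unitfE invr_eq0.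
Qed.

Lemma nu_density x : O x -> nu (rho x) * s x = mu x.
Proof.
move=> Ox; rewrite hnu // metric_gram // -/(s x) divfK //.
exact/lt0r_neq0/volume_density_gt0.
Qed.

Lemma nu_gt0 x : O x -> 0 < nu (rho x).
Proof.
move=> Ox; rewrite -(pmulr_lgt0 _ (volume_density_gt0 arho Ox)) nu_density //.
exact: weight_gt0.
Qed.

Lemma nuE x : O x -> nu (rho x) = mu x / s x.
Proof. by move=> Ox; rewrite hnu // metric_gram. Qed.

Lemma nu_measurable :
  measurable_fun (O : set (borel E)) ((fun x => nu (rho x)) : borel E -> R).
Proof.
have s0 x : O x -> s x != 0 by move=> Ox; exact/lt0r_neq0/volume_density_gt0.
have cnu : Ck 0 O (fun x => mu x * (s x)^-1).
  apply: Ck_mul; [exact: domain_open|exact: (smooth_mu 0)|].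
  by apply: Ck_inv => //; [exact: domain_open|exact: volume_density_smooth].
apply: (@Ck_measurable _ _ 0); first exact: domain_open.
by apply: (Ck_ext (domain_open arho) _ cnu) => x Ox; rewrite nuE.
Qed.

Lemma ge0_integral_chart (f : M -> \bar R) :
  measurable_fun (U : set (borel M)) (f : borel M -> \bar R) ->
  (forall p, U p -> 0 <= f p)%E ->
  (\int[vol]_(p in (U : set (borel M))) f p =
   \int[lam]_(x in (O : set (borel E))) (f (rho x) * (s x)%:E))%E.
Proof.
apply: (@ge0_integral_density _ _ (borel E) (borel M) R lam vol O U rho s).
- exact: domain_measurable.
- exact: image_measurable.
- exact: rho_measurable.
- by move=> x; exact: cimg_cmap.
- exact: density_measurable.
- by move=> x Ox; exact/ltW/volume_density_gt0.
- by move=> A mA AU; exact: hvol.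
Qed.

Lemma Rintegral_chart (f : M -> R) :
  measurable_fun (O : set (borel E)) (f \o rho : borel E -> R) ->
  \int[vol]_(p in (U : set (borel M))) f p =
  \int[lam]_(x in (O : set (borel E))) (f (rho x) * s x).
Proof.
move=> /(chart_measurable arho).
apply: (@Rintegral_density _ _ (borel E) (borel M) R lam vol O U rho s).
- exact: domain_measurable.
- exact: image_measurable.
- exact: rho_measurable.
- by move=> x; exact: cimg_cmap.
- exact: density_measurable.
- by move=> x Ox; exact/ltW/volume_density_gt0.
- by move=> A mA AU; exact: hvol.
Qed.

Definition pullbackR (r : pairMR M) : pairR R d :=
  (fun x => r.1 (rho x), fun x => adjoint (dchart rho (rho x)) (r.2 (rho x))).

Lemma re_pullback v : re_pair (pullback rho v) = pullbackR (re_pairM v).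
Proof. by congr pair; apply/funext => x; rewrite re_vecC. Qed.

Lemma im_pullback v : im_pair (pullback rho v) = pullbackR (im_pairM v).
Proof. by congr pair; apply/funext => x; rewrite im_vecC. Qed.

Lemma pullbackR_field r x : O x ->
  (pullbackR r).2 x = chart_field rho r.2 x *m gram rho x.
Proof. by move=> Ox; rewrite /= adjointE. Qed.

(** The matrix weight undoes the metric, which is the reason for its relation
    with [g]. *)
Lemma pullbackR_weight r x : O x ->
  (pullbackR r).2 x *m (W x)^T = mu x *: chart_field rho r.2 x.
Proof.
move=> Ox; rewrite pullbackR_field // matrix_weight_gram // linearZ /= trmx_inv gramT.
by rewrite -scalemxAr mulmxK // gram_unit.
Qed.

Definition measurable_pairMR (r : pairMR M) :=
  measurable_fun (U : set (borel M)) (r.1 : borel M -> R) /\ measurable_fieldM rho r.2.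

Lemma measurable_pullbackR r : measurable_pairMR r ->
  measurable_fun (O : set (borel E)) ((pullbackR r).1 : borel E -> R) /\
  measurable_field O (pullbackR r).2.
Proof.
move=> [m1 m2]; split; first exact: measurable_chart.
have := measurable_fieldMx (measurable_fieldM_chart arho m2) (gram_measurable arho).
move=> H i; apply: (eq_measurable_fun _ _ (H i)) => x /[!inE] Ox.
by rewrite pullbackR_field.
Qed.

Lemma measurable_re v : measurable_pairM U v -> measurable_pairMR (re_pairM v).
Proof. by move=> /(_ _ (or_introl erefl)). Qed.

Lemma measurable_im v : measurable_pairM U v -> measurable_pairMR (im_pairM v).
Proof. by move=> /(_ _ (or_intror erefl)). Qed.

Lemma measurable_pullback v : measurable_pairM U v -> measurable_pair O (pullback rho v).
Proof.
move=> mv r [->|->]; rewrite ?re_pullback ?im_pullback.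
  exact/measurable_pullbackR/measurable_re.
exact/measurable_pullbackR/measurable_im.
Qed.

Lemma inner_chart (X Y : forall p : M, tangent p) x : O x ->
  inner (X (rho x)) (Y (rho x)) =
  dot (chart_field rho X x *m gram rho x) (chart_field rho Y x).
Proof. by move=> Ox; exact: inner_gram. Qed.

Lemma measurable_inner (X Y : forall p : M, tangent p) :
  measurable_field O (chart_field rho X) -> measurable_field O (chart_field rho Y) ->
  measurable_fun (O : set (borel E))
    ((fun x => inner (X (rho x)) (Y (rho x))) : borel E -> R).
Proof.
move=> mX mY.
have H := measurable_dot (measurable_fieldMx mX (gram_measurable arho)) mY.
by apply: (eq_measurable_fun _ _ H) => x /[!inE] Ox; rewrite inner_chart.
Qed.

Lemma sqnorm_pullback v : measurable_pairM U v ->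
  sqnorm_pair lam mu W O (pullback rho v) = sqnorm_pairM vol nu U v.
Proof.
move=> mv; have [m1 m2] := measurable_re mv; have [m3 m4] := measurable_im mv.
have nu0 p : U p -> 0 <= nu p by move=> [x Ox <-]; exact/ltW/nu_gt0.
congr (_ + _)%E.
  rewrite ge0_integral_chart.
  - apply: eq_integral => x /[!inE] Ox /=.
    by rewrite -EFinM -mulrA nu_density.
  - apply/measurable_EFinP; apply: chart_measurable => //.
    apply: measurable_funM; last exact: nu_measurable.
    apply: measurable_funD; apply: measurable_funX.
      exact: (measurable_chart arho m1).
    exact: (measurable_chart arho m3).
  - move=> p Up; rewrite lee_fin mulr_ge0 ?nu0 // /sqnormC.
    by rewrite addr_ge0 ?sqr_ge0.
have inner_ge0 p (xi : tangent p) : 0 <= inner xi xi.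
  by have [->|/inner_gt0/ltW//] := eqVneq xi 0; rewrite inner0l.
rewrite ge0_integral_chart.
- apply: eq_integral => x /[!inE] Ox; rewrite hermC_vecC -EFinM; congr EFin.
  have h (X : forall p : M, tangent p) :
      let a := adjoint (dchart rho (rho x)) (X (rho x)) in
      dot (a *m (W x)^T) a = mu x * inner (X (rho x)) (X (rho x)).
    have := pullbackR_weight (fun=> 0, X) Ox; rewrite /= => ->.
    by rewrite dotZl adjointE // dotC -inner_gram.
  rewrite (h (fun p => (v.2 p).1)) (h (fun p => (v.2 p).2)) -mulrDr /sqnormTC.
  by rewrite -mulrA nu_density // mulrC.
- apply/measurable_EFinP; apply: chart_measurable => //.
  apply: measurable_funM; last exact: nu_measurable.
  apply: measurable_funD.
    by apply: (@measurable_inner (fun p => (v.2 p).1) (fun p => (v.2 p).1));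
      exact: measurable_fieldM_chart.
  by apply: (@measurable_inner (fun p => (v.2 p).2) (fun p => (v.2 p).2));
    exact: measurable_fieldM_chart.
- move=> p Up; rewrite lee_fin mulr_ge0 ?nu0 // /sqnormTC.
  by rewrite addr_ge0 ?inner_ge0.
Qed.

Lemma eq_sqnorm_pair u u' : (forall x, O x -> u.1 x = u'.1 x /\ u.2 x = u'.2 x) ->
  sqnorm_pair lam mu W O u = sqnorm_pair lam mu W O u'.
Proof.
move=> uE; apply: (@f_equal2 _ _ _ adde); apply: eq_integral => x /[!inE] Ox.
  by rewrite (uE x Ox).1.
by rewrite (uE x Ox).2.
Qed.

Lemma L2_pullback v : L2_pairM vol nu U v -> L2_pair lam mu W O (pullback rho v).
Proof.
by move=> [mv fv]; split; [exact: measurable_pullback|rewrite sqnorm_pullback].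
Qed.

Lemma pullback_linear (a : R[i]) (v w : pairMC M) x : O x ->
  (pullback rho (lin_pairM a v w)).1 x =
    (lin_pair a (pullback rho v) (pullback rho w)).1 x /\
  (pullback rho (lin_pairM a v w)).2 x =
    (lin_pair a (pullback rho v) (pullback rho w)).2 x.
Proof.
move=> Ox; split=> //=; rewrite !adjointE // !tcoordD ?tcoordN !tcoordZ.
rewrite !mulmxDl !mulNmx -!scalemxAl vecC_lin.
by case: a.
Qed.

(** The field is transported by the differential of [rho], after undoing the
    matrix of the metric which the adjoint brings in. *)
Lemma pullback_onto u : measurable_pair O u ->
  exists2 v, measurable_pairM U v & forall x, O x ->
    (pullback rho v).1 x = u.1 x /\ (pullback rho v).2 x = u.2 x.
Proof.
move=> mu'.
pose X (F : E -> E) p : tangent p :=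
  dchart rho p (F (cinv rho p) *m invmx (gram rho (cinv rho p))).
have XE F x : O x -> chart_field rho (X F) x = F x *m invmx (gram rho x).
  move=> Ox; rewrite /chart_field /X tcoord_dchart ?cmapK //.
  exact: chart_at_cmap.
pose v : pairMC M := (fun p => u.1 (cinv rho p),
  fun p => (X (re_pair u).2 p, X (im_pair u).2 p)).
have adjX F x : O x -> adjoint (dchart rho (rho x)) (X F (rho x)) = F x.
  move=> Ox; rewrite adjointE //; have := XE F x Ox; rewrite /chart_field => ->.
  by rewrite mulmxKV // gram_unit.
exists v; last first.
  move=> x Ox; split; first by rewrite /= cmapK.
  rewrite /= !adjX //; apply/rowP => i; rewrite !mxE.
  by case: (u.2 x 0 i).
have minv i j : measurable_fun (O : set (borel E))
    ((fun x => invmx (gram rho x) i j) : borel E -> R).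
  (* Cramer's rule expresses the entries of the inverse by determinants *)
  have H : measurable_fun (O : set (borel E))
      ((fun x => (\det (gram rho x))^-1 * (\adj (gram rho x)) i j) : borel E -> R).
    apply: (@Ck_measurable _ _ 0); first exact: domain_open.
    have cdet n (A : E -> 'M[R]_n) : (forall i j, Ck 0 O (fun x => A x i j)) ->
        Ck 0 O (fun x => \det (A x)) by apply: Ck_det; exact: domain_open.
    apply: Ck_mul; first exact: domain_open.
      apply: Ck_inv; [exact: domain_open| |by apply: cdet => *; exact: gram_smooth].
      by move=> x Ox; exact/lt0r_neq0/gram_det_gt0.
    rewrite (_ : (fun x => _) = fun x => (-1) ^+ (j + i) *
        \det (row' j (col' i (gram rho x)))); last by apply/funext => x; rewrite mxE.
    apply: Ck_mul; [exact: domain_open|exact: Ck_cst|apply: cdet => k l].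
    rewrite (_ : (fun x => _) = fun x => gram rho x (lift j k) (lift i l)).
      exact: gram_smooth.
    by apply/funext => x; rewrite !mxE.
  apply: (eq_measurable_fun _ _ H) => x /[!inE] Ox.
  by rewrite /invmx (gram_unit arho Ox) [RHS]mxE.
have mX F : measurable_field O F -> measurable_fieldM rho (X F).
  move=> mF; apply: chart_measurable_fieldM => // i.
  apply: (eq_measurable_fun _ _ (measurable_fieldMx mF minv i)) => x /[!inE] Ox.
  by rewrite XE.
move=> r [->|->].
  have [m1 m2] := mu' _ (or_introl erefl); split; last exact: mX m2.
  apply: chart_measurable => //; apply: (eq_measurable_fun _ _ m1) => x /[!inE] Ox.
  by rewrite /= cmapK.
have [m1 m2] := mu' _ (or_intror erefl); split; last exact: mX m2.
apply: chart_measurable => //; apply: (eq_measurable_fun _ _ m1) => x /[!inE] Ox.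
by rewrite /= cmapK.
Qed.

Lemma diverg_measurable (F : E -> E) : (forall i, Ck 1 O (fun x => F x 0 i)) ->
  measurable_fun (O : set (borel E)) (diverg F : borel E -> R).
Proof.
move=> cF; apply: (@Ck_measurable _ _ 0); first exact: domain_open.
by apply: Ck_sum; [exact: domain_open|move=> i _; exact: (cF i).2].
Qed.

Lemma chart_field_differentiable X x : CkTM 1 U X -> O x ->
  differentiable (chart_field rho X) x.
Proof.
move=> cX; apply: (@Ck_row_differentiable _ _ 0) => i.
exact: CkTM_chart cX.
Qed.

(** The factor [s] in [F = s X] is the density of the Riemannian measure: it turns
    the Riemannian divergence into the Euclidean one and the metric product with
    [X] into the Euclidean product with [F]. *)
Lemma weak_gradient_chart (r t : pairMR M) X F :
  measurable_pairMR r -> measurable_pairMR t ->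
  test_fieldM U X -> test_field O F ->
  (forall x, O x -> F x = s x *: chart_field rho X x) ->
  \int[vol]_(p in (U : set (borel M))) (r.1 p * divergM X p) =
    \int[lam]_(x in (O : set (borel E))) ((pullbackR r).1 x * diverg F x) /\
  \int[vol]_(p in (U : set (borel M))) inner (t.2 p) (X p) =
    \int[lam]_(x in (O : set (borel E))) dot ((pullbackR t).2 x) (F x).
Proof.
move=> [mr _] [_ mt] [sX _] [sF _] FE.
have s0 x : O x -> s x != 0 by move=> Ox; exact/lt0r_neq0/volume_density_gt0.
have divE x : O x -> divergM X (rho x) = (s x)^-1 * diverg F x.
  move=> Ox; rewrite (divergME arho Ox); last exact: chart_field_differentiable.
  congr (_ * _); apply: near_eq_diverg.
  by apply: nbhs_in_open (domain_open arho) Ox _ => y Oy; rewrite FE.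
have mF : measurable_fun (O : set (borel E)) (diverg F : borel E -> R).
  by apply: diverg_measurable => i; exact: sF.
have mX : measurable_field O (chart_field rho X).
  move=> i; apply: (@Ck_measurable _ _ 0); first exact: domain_open.
  exact: CkTM_chart (sX 0).
have msV : measurable_fun (O : set (borel E)) ((fun x => (s x)^-1) : borel E -> R).
  apply: (@Ck_measurable _ _ 0); first exact: domain_open.
  by apply: Ck_inv => //; [exact: domain_open|exact: volume_density_smooth].
split; rewrite Rintegral_chart.
- apply: eq_Rintegral => x /[!inE] Ox /=.
  by rewrite divE // -mulrA [_ * s x]mulrC mulVKf ?s0.
- apply: (@measurable_funM _ (borel E) R O (r.1 \o rho) (divergM X \o rho)).
    exact: measurable_chart.
  apply: (eq_measurable_fun _ _ (measurable_funM msV mF)) => x /[!inE] Ox.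
  by rewrite /= divE.
- apply: eq_Rintegral => x /[!inE] Ox.
  rewrite inner_chart // -pullbackR_field // FE //.
  by rewrite [RHS]dotC dotZl mulrC dotC.
- by apply: measurable_inner => //; exact: measurable_fieldM_chart.
Qed.

Lemma dot_grad (h : E -> R) x v : differentiable h x -> dot v (grad h x) = 'D_v h x.
Proof.
move=> dh; rewrite derive_coordE //; apply: eq_bigr => i _.
by rewrite mxE.
Qed.

(** In coordinates the metric product with the gradient is the derivative along
    the field; the scalar factors match because [nu s = mu]. *)
Lemma weak_divergence_chart (r t : pairMR M) phi h :
  measurable_pairMR r -> measurable_pairMR t ->
  test_funM U phi -> test_fun O h -> (forall x, O x -> h x = phi (rho x)) ->
  \int[vol]_(p in (U : set (borel M))) inner (nu p *: r.2 p) (gradM phi p) =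
    \int[lam]_(x in (O : set (borel E)))
      dot ((pullbackR r).2 x *m (W x)^T) (grad h x) /\
  \int[vol]_(p in (U : set (borel M))) (- (nu p * t.1 p) * phi p) =
    \int[lam]_(x in (O : set (borel E))) (- (mu x * (pullbackR t).1 x) * h x).
Proof.
move=> [_ mr] [mt _] [sphi _] [sh _] hE.
have dh x : O x -> differentiable h x by exact: (sh 1).1.
have dphi x : O x -> differentiable (phi \o rho) x.
  exact: (CkM_chart arho (sphi 1)).1.
have innE x : O x -> inner (nu (rho x) *: r.2 (rho x)) (gradM phi (rho x)) =
    nu (rho x) * dot (chart_field rho r.2 x) (grad h x).
  move=> Ox; rewrite innerZl inner_sym gradM_inner (dfunE _ arho Ox (dphi x Ox)).
  rewrite (dot_grad _ (dh x Ox)) -(deriveE _ (dphi x Ox)); congr (_ * _).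
  apply: near_eq_derive; apply: nbhs_in_open (domain_open arho) Ox _ => y Oy.
  by rewrite hE.
have mgrad : measurable_field O (grad h).
  move=> i.
  have H := @Ck_measurable _ _ 0 _ ('D_(delta_mx 0 i) h) (domain_open arho)
    ((sh 1).2 _).
  by apply: (eq_measurable_fun _ _ H) => x _; rewrite mxE.
split; rewrite Rintegral_chart.
- apply: eq_Rintegral => x /[!inE] Ox.
  by rewrite innE // pullbackR_weight // dotZl mulrAC nu_density.
- have H := measurable_funM nu_measurable
    (measurable_dot (measurable_fieldM_chart arho mr) mgrad).
  by apply: (eq_measurable_fun _ _ H) => x /[!inE] Ox; rewrite /= innE.
- apply: eq_Rintegral => x /[!inE] Ox /=.
  by rewrite hE // -nu_density //; ring.
- have H := measurable_funM (measurable_funN (measurable_funM nu_measurable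
    (measurable_chart arho mt))) (Ck_measurable (domain_open arho) (sh 0)).
  by apply: (eq_measurable_fun _ _ H) => x /[!inE] Ox; rewrite /= hE.
Qed.

Lemma Dweak_chart (r t : pairMR M) : measurable_pairMR r -> measurable_pairMR t ->
  Dweak_R lam mu W O (pullbackR r) (pullbackR t) <-> DweakM_R vol nu U r t.
Proof.
move=> mr mt; split=> -[wgrad wdiv]; split.
- move=> X tX; have [F tF FE] := test_fieldM_chart arho tX.
  by have [-> ->] := weak_gradient_chart mr mt tX tF FE; exact: wgrad.
- move=> phi tphi; have [h th hE] := test_funM_chart arho tphi.
  by have [-> ->] := weak_divergence_chart mr mt tphi th hE; exact: wdiv.
- move=> F tF; have [X tX FE] := chart_test_fieldM arho tF.
  by have [<- <-] := weak_gradient_chart mr mt tX tF FE; exact: wgrad.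
- move=> h th; have [phi tphi hE] := chart_test_funM arho th.
  by have [<- <-] := weak_divergence_chart mr mt tphi th hE; exact: wdiv.
Qed.

Lemma Dgraph_pullback v w : L2_pairM vol nu U v -> L2_pairM vol nu U w ->
  (Dgraph lam mu W O (pullback rho v) (pullback rho w) <-> DgraphM vol nu U v w).
Proof.
move=> lv lw; have lPv := L2_pullback lv; have lPw := L2_pullback lw.
have re := Dweak_chart (measurable_re lv.1) (measurable_re lw.1).
have im := Dweak_chart (measurable_im lv.1) (measurable_im lw.1).
rewrite /Dgraph /DgraphM !re_pullback !im_pullback.
by split=> -[_ _ /re ? /im ?]; split.
Qed.

(** For the first component, [mu a = s (nu a)] makes the two divergences equal
    up to the factor [s^-1] of the Riemannian one. For the second, both sides
    represent the differential of [r.1 \o rho] in the Euclidean product. *)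
Lemma DopR_chart (r : pairMR M) x : CkM 1 U r.1 -> CkTM 1 U r.2 -> O x ->
  (DopR mu W (pullbackR r)).1 x = (pullbackR (DopMR nu r)).1 x /\
  (DopR mu W (pullbackR r)).2 x = (pullbackR (DopMR nu r)).2 x.
Proof.
move=> cr1 cr2 Ox; split=> /=.
  have dX : differentiable (chart_field rho r.2) x by exact: chart_field_differentiable.
  have s0 y : O y -> s y != 0 by move=> Oy; exact/lt0r_neq0/volume_density_gt0.
  have dnu : differentiable (fun y => mu y * (s y)^-1) x.
    have cnu : Ck 1 O (fun y => mu y * (s y)^-1).
      apply: Ck_mul; [exact: domain_open|exact: (smooth_mu 1)|].
      by apply: Ck_inv => //; [exact: domain_open|exact: volume_density_smooth].
    exact: cnu.1 x Ox.
  have dnuX : differentiable (fun y => tcoord (nu (rho y) *: r.2 (rho y)) rho) x.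
    have nnu : {near x, (fun y => (mu y * (s y)^-1) *: chart_field rho r.2 y) =1
        (fun y => tcoord (nu (rho y) *: r.2 (rho y)) rho)}.
      by apply: nbhs_in_open (domain_open arho) Ox _ => y Oy; rewrite tcoordZ nuE.
    apply: (near_eq_differentiable nnu _).1; apply: differentiable_row => i.
    rewrite (_ : (fun y => _) = (fun y => mu y * (s y)^-1) *
      (fun y => chart_field rho r.2 y 0 i)); last by apply/funext => y; rewrite mxE.
    by apply: differentiableM dnu _; exact: differentiable_coordinate dX.
  rewrite (@divergME _ _ _ _ (fun q => nu q *: r.2 q) x arho Ox dnuX) mulrA.
  congr (_ * _); first by rewrite mulNr -invfM nu_density.
  apply: near_eq_diverg; apply: nbhs_in_open (domain_open arho) Ox _ => y Oy.
  have -> := pullbackR_weight r Oy.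
  by rewrite tcoordZ scalerA [s y * _]mulrC nu_density.
have df : differentiable (r.1 \o rho) x by exact: (CkM_chart arho cr1).1.
apply: dot_inj => b; rewrite dotC dot_grad // deriveE //.
have pc := chart_at_cmap arho Ox.
rewrite adjointE // -{2}(tcoord_dchart b pc) -inner_gram // gradM_inner.
by rewrite (dfunE _ arho Ox df) tcoord_dchart.
Qed.

Lemma Dop_pullback v x : CkM_pair 1 U v -> O x ->
  (Dop mu W (pullback rho v)).1 x = (pullback rho (DopM nu v)).1 x /\
  (Dop mu W (pullback rho v)).2 x = (pullback rho (DopM nu v)).2 x.
Proof.
move=> [c1 c2 c3 c4] Ox.
have [re1 re2] := DopR_chart c1 c2 Ox; have [im1 im2] := DopR_chart c3 c4 Ox.
rewrite /Dop re_pullback im_pullback; split.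
  by move: re1 im1 => /= -> ->.
by move: re2 im2 => /= -> ->.
Qed.

End Weights.

Theorem lemma2p1 (R : realType) (d : nat)
  (lam : {measure set (borel 'rV[R]_d) -> \bar R})
  (hlam : is_lebesgue_measure lam)
  (mu : 'rV[R]_d -> R) (W : 'rV[R]_d -> 'M[R]_d)
  (hmu : scalar_weight lam mu) (hW : matrix_weight lam W)
  (M : riemannian R d) (vol : {measure set (borel M) -> \bar R})
  (hvol : riemannian_measure lam vol)
  (rho : chart R d M) (hrho : atlas rho)
  (x0 : 'rV[R]_d) (hx0 : cdom rho x0)
  (smooth_mu : smooth_on (cdom rho) mu)
  (smooth_W : forall i j, smooth_on (cdom rho) (fun x => W x i j))
  (g : 'rV[R]_d -> 'M[R]_d)
  (hg : forall x, cdom rho x -> g x = mu x *: invmx (W x))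
  (nu : M -> R)
  (hnu : forall x, cdom rho x -> nu (rho x) = mu x / Num.sqrt (\det (g x)))
  (hmetric : forall x, cdom rho x -> forall a : 'rV[R]_d,
     adjoint (dchart rho (rho x)) (dchart rho (rho x) a) = a *m (g x)^T) :
  let O := cdom rho in
  let U := cimg rho in
  let P := pullback rho in
  ((forall v, L2_pairM vol nu U v ->
      L2_pair lam mu W O (P v) /\
      sqnorm_pair lam mu W O (P v) = sqnorm_pairM vol nu U v) /\
   (forall (a : R[i]) v w x, O x ->
      (P (lin_pairM a v w)).1 x = (lin_pair a (P v) (P w)).1 x /\
      (P (lin_pairM a v w)).2 x = (lin_pair a (P v) (P w)).2 x) /\
   (forall u, L2_pair lam mu W O u -> exists2 v, L2_pairM vol nu U v &
      {ae lam, forall x, O x -> (P v).1 x = u.1 x /\ (P v).2 x = u.2 x})) /\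
  ((forall v w, L2_pairM vol nu U v -> L2_pairM vol nu U w ->
      (Dgraph lam mu W O (P v) (P w) <-> DgraphM vol nu U v w)) /\
   (forall v, CkM_pair 1 U v -> forall x, O x ->
      (Dop mu W (P v)).1 x = (P (DopM nu v)).1 x /\
      (Dop mu W (P v)).2 x = (P (DopM nu v)).2 x)).
Proof.
move=> O U P; split; [split; [|split]|split].
- move=> v Lv; split.
    exact: (L2_pullback hlam hmu hvol hrho smooth_mu hg hnu hmetric Lv).
  exact: (sqnorm_pullback hlam hmu hvol hrho smooth_mu hg hnu hmetric Lv.1).
- by move=> a v w x; exact: pullback_linear.
- move=> u [mu_ fu]; have [v mv vE] := pullback_onto hrho mu_.
  exists v; last by apply: aeW => x Ox; exact: vE.
  split=> //; rewrite -(sqnorm_pullback hlam hmu hvol hrho smooth_mu hg hnu hmetric mv).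
  by rewrite (eq_sqnorm_pair vE).
- move=> v w; exact: (Dgraph_pullback hlam hmu hvol hrho smooth_mu hg hnu hmetric).
- move=> v cv x; exact: (Dop_pullback hlam hmu hrho smooth_mu hg hnu hmetric).
Qed.
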